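(* Let $L$ be a compact metric space and let $K$ be a compact space. Then the following assertions are equivalent: \begin{enumerate} \item[(i)] $C(K)$ contains an isometric copy of $C(L)$; \item[(ii)] there exists a closed subset of $K$ which maps continuously onto $L$; \item[(iii)] $|L^{(\alpha)}|\le |K^{(\alpha)}|$ for each ordinal number $\alpha$; \item[(iv)] $ht(L)\le ht(K)$, and if $L$ is scattered, then $|L^{(ht(L)-1)}|\le |K^{(ht(L)-1)}|$; \item[(v)] $C(K)$ contains a positive isometric copy of $C(L)$; \item[(vi)] there is an isomorphic embedding $T\colon C(L)\to C(K)$ with $\|T\|\,\|T^{-1}\|<3$. \end{enumerate}
   Context: All compact spaces are Hausdorff. All Banach spaces are real and of dimension at least one, so the compact spaces considered here are nonempty. $C(K)$ is the Banach space (and Banach lattice, with pointwise order) of continuous real-valued functions on $K$ with the supremum norm. Embeddings of Banach spaces are linear: an isomorphic embedding is a bounded linear operator that is an isomorphism onto its image, and $T^{-1}$ is then the inverse defined on the image; an isometric embedding is a linear norm-preserving map. $C(K)$ contains an isometric copy (resp. a positive isometric copy) of $C(L)$ if there is an isometric embedding $T\colon C(L)\to C(K)$ (resp. one with $T(f)\ge 0$ whenever $f\ge 0$). Cantor--Bendixson derivatives: for a topological space $S$, $S^{(0)}=S$, $S^{(1)}$ is the set of accumulation points of $S$, $S^{(\alpha)}=(S^{(\beta)})^{(1)}$ for $\alpha=\beta+1$, and $S^{(\alpha)}=\bigcap_{\beta<\alpha}S^{(\beta)}$ for limit $\alpha$. The perfect kernel $S^{(\infty)}$ is the eventual constant value of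 $S^{(\alpha)}$. $S$ is scattered if $S^{(\infty)}=\emptyset$, and then the height $ht(S)$ is the least ordinal $\alpha$ with $S^{(\alpha)}=\emptyset$ (for a nonempty scattered compact space it is a successor ordinal, and $ht(S)-1$ is its predecessor). If $S$ is not scattered, $ht(S)=\infty$, with the convention $\alpha<\infty$ for every ordinal $\alpha$. $|X|$ denotes the cardinality of $X$. *)

(* Defs.v *)
From HB Require Import structures.
From mathcomp Require Import all_boot all_order all_algebra.
From mathcomp Require Import all_classical all_reals all_analysis.
From mathcomp Require wochoice.

Set Implicit Arguments.
Unset Strict Implicit.
Unset Printing Implicit Defensive.

Import Order.TTheory GRing.Theory Num.Theory.
Import numFieldNormedType.Exports.

Local Open Scope classical_set_scope.
Local Open Scope ring_scope.

(* The Banach space C(K); compactness is part of the type because the supremum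
   norm installed below is a norm only on bounded functions. *)
Definition cspace (R : realType) (K : topologicalType)
  (cK : compact [set: K]) : Type := continuousType K R.

Section cspace.
Context (R : realType) (K : topologicalType) (cK : compact [set: K]).
Local Notation C := (cspace R cK).

HB.instance Definition _ := Choice.copy C (continuousType K R).

Definition cspace_of (f : K -> R) (cf : continuous f) : C := mkcts cf.

Definition cspace_fun (f : C) : K -> R := @Continuous.sort K R f.

Lemma cspaceP (f g : C) : cspace_fun f =1 cspace_fun g -> f = g.
Proof. by move=> fg; apply/continuousEP. Qed.

Lemma cspace_cts (f : C) : continuous (cspace_fun f).
Proof. exact: (@cts_fun K R f). Qed.

Lemma cspace_cts0 : continuous (fun _ : K => 0 : R).
Proof. by move=> x; exact: cvg_cst. Qed.

Lemma cspace_ctsN (f : C) : continuous (fun x => - cspace_fun f x).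
Proof. by move=> x; apply: cvgN; exact: cspace_cts. Qed.

Lemma cspace_ctsD (f g : C) :
  continuous (fun x => cspace_fun f x + cspace_fun g x).
Proof. by move=> x; apply: cvgD; exact: cspace_cts. Qed.

Lemma cspace_ctsZ (a : R) (f : C) : continuous (fun x => a * cspace_fun f x).
Proof. by move=> x; apply: cvgMr; exact: cspace_cts. Qed.

Let zero : C := cspace_of cspace_cts0.
Let opp (f : C) : C := cspace_of (@cspace_ctsN f).
Let add (f g : C) : C := cspace_of (@cspace_ctsD f g).
Let scale (a : R) (f : C) : C := cspace_of (@cspace_ctsZ a f).

Let addA : associative add.
Proof. by move=> f g h; apply: cspaceP => x; exact: addrA. Qed.
Let addC : commutative add.
Proof. by move=> f g; apply: cspaceP => x; exact: addrC. Qed.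
Let add0 : left_id zero add.
Proof. by move=> f; apply: cspaceP => x; exact: add0r. Qed.
Let addN : left_inverse zero opp add.
Proof. by move=> f; apply: cspaceP => x; exact: addNr. Qed.

HB.instance Definition _ := GRing.isZmodule.Build C addA addC add0 addN.

Let scaleA a b f : scale a (scale b f) = scale (a * b) f.
Proof. by apply: cspaceP => x; exact: mulrA. Qed.
Let scale1 : left_id 1 scale.
Proof. by move=> f; apply: cspaceP => x; exact: mul1r. Qed.
Let scaleDr : right_distributive scale +%R.
Proof. by move=> a f g; apply: cspaceP => x; exact: mulrDr. Qed.
Let scaleDl f : {morph scale^~ f : a b / a + b}.
Proof. by move=> a b; apply: cspaceP => x; exact: mulrDl. Qed.

HB.instance Definition _ :=
  GRing.Zmodule_isLmodule.Build R C scaleA scale1 scaleDr scaleDl.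

Definition supnorm (f : C) : R := sup [set `|cspace_fun f x| | x in [set: K]].

Lemma supnorm_has_ub (f : C) :
  has_ubound [set `|cspace_fun f x| | x in [set: K]].
Proof.
have cf : compact (cspace_fun f @` [set: K]).
  apply: continuous_compact => //.
  by apply: continuous_subspaceT; exact: cspace_cts.
have [M [_ Mf]] := compact_bounded cf.
exists (M + 1) => _ [x _ <-].
by apply: (Mf (M + 1)); [rewrite ltrDl|exists x].
Qed.

Lemma le_supnorm (f : C) x : `|cspace_fun f x| <= supnorm f.
Proof. by apply: ub_le_sup; [exact: supnorm_has_ub|exists x]. Qed.

Lemma supnorm_ge0 f : 0 <= supnorm f.
Proof.
have [E|/set0P[_ [x _ _]]] := eqVneq [set `|cspace_fun f x| | x in setT] set0.
  by rewrite /supnorm E sup0.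
exact: le_trans (le_supnorm f x).
Qed.

Lemma supnorm_le (f : C) (M : R) :
  0 <= M -> (forall x, `|cspace_fun f x| <= M) -> supnorm f <= M.
Proof.
move=> M0 fM.
have [E|/set0P ne] := eqVneq [set `|cspace_fun f x| | x in [set: K]] set0.
  by rewrite /supnorm E sup0.
by apply: ge_sup => // _ [x _ <-].
Qed.

Let ler_supnormD f g : supnorm (f + g) <= supnorm f + supnorm g.
Proof.
apply: supnorm_le => [|x]; first by rewrite addr_ge0// supnorm_ge0.
by apply: (le_trans (ler_normD _ _)); rewrite lerD// le_supnorm.
Qed.

Let supnormZ (a : R) f : supnorm (a *: f) = `|a| * supnorm f.
Proof.
have le b g : supnorm (b *: g) <= `|b| * supnorm g.
  apply: supnorm_le => [|x]; first by rewrite mulr_ge0// supnorm_ge0.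
  by rewrite /cspace_fun/= normrM ler_wpM2l// le_supnorm.
have [->|a0] := eqVneq a 0.
  rewrite normr0 mul0r; apply/eqP; rewrite eq_le supnorm_ge0 andbT.
  by have := le 0 f; rewrite normr0 mul0r.
apply/eqP; rewrite eq_le le/=.
have := le a^-1 (a *: f); rewrite scalerA mulVf// scale1r normfV.
by rewrite -ler_pdivrMl ?invr_gt0 ?normr_gt0// invrK.
Qed.

Let supnorm0_eq0 f : supnorm f = 0 -> f = 0.
Proof.
move=> f0; apply: cspaceP => x; apply/eqP.
by rewrite -[_ == _]normr_le0 -f0 le_supnorm.
Qed.

HB.instance Definition _ :=
  Lmodule_isNormed.Build R C ler_supnormD supnormZ supnorm0_eq0.

End cspace.

Coercion cspace_fun : cspace >-> Funclass.

Section operators.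
Context (R : realType) (V W : normedModType R).

(* D is the domain of the operator g: a linear subspace of V *)
Definition bounded_op (D : set V) (g : V -> W) : Prop :=
  exists M : R, forall x, D x -> `|g x| <= M * `|x|.

Definition opnorm (D : set V) (g : V -> W) : R :=
  sup [set `|g x| | x in D `&` [set x | `|x| <= 1]].

End operators.

(* T is an isomorphism onto its image, with inverse g, whose values outside
   the image of T are irrelevant *)
Definition isomorphic_embedding (R : realType) (V W : normedModType R)
    (T : {linear V -> W}) (g : W -> V) : Prop :=
  [/\ bounded_op setT T, cancel T g & bounded_op (range T) g].

Definition isometric_embedding (R : realType) (V W : normedModType R)
    (T : {linear V -> W}) : Prop :=
  forall f, `|T f| = `|f|.

Definition positive_op (R : realType) (L K : topologicalType)
    (cL : compact [set: L]) (cK : compact [set: K])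
    (T : cspace R cL -> cspace R cK) : Prop :=
  forall f : cspace R cL, (forall x, 0 <= f x) -> forall y, 0 <= T f y.

(* An ordinal number is represented by a well-ordered type of that order type:
   isomorphic well-ordered types denote the same ordinal, and the ordinals below
   w are its proper initial segments. *)
Record wotype := Wotype {
  wosort :> Type;
  wle : rel wosort;
  wle_wo : wochoice.well_order wle }.

Definition wlt (w : wotype) (x y : w) : Prop := wle x y /\ x <> y.

Section wotype_theory.
Context (w : wotype).
Implicit Types (x y z : w) (P : set w).

Lemma wle_min P : P !=set0 -> exists2 z, P z & forall x, P x -> wle z x.
Proof.
move=> [x Px].
have [|z [[Az lz] _]] := @wle_wo w [pred t | `[< P t >]].
  by exists x; rewrite inE.
exists z; first by move: Az; rewrite inE.
by move=> t Pt; apply: lz; rewrite inE.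
Qed.

Lemma wle_total x y : wle x y \/ wle y x.
Proof.
have [|z [->|->] lz] := @wle_min [set t | t = x \/ t = y]; first by exists x; left.
- by left; apply: lz; right.
- by right; apply: lz; left.
Qed.

Lemma wle_refl x : wle x x.
Proof. by case: (wle_total x x). Qed.

Lemma wle_anti x y : wle x y -> wle y x -> x = y.
Proof.
move=> xy yx.
have [|z [_ uz]] := @wle_wo w [pred t | `[< t = x \/ t = y >]].
  by exists x; rewrite inE; left.
have H t : t = x \/ t = y -> z = t.
  move=> tE; apply: uz; split; first by rewrite inE.
  move=> s; rewrite inE => -[]->; case: tE => -> //; exact: wle_refl.
by rewrite -(H x (or_introl erefl)) -(H y (or_intror erefl)).
Qed.

Lemma wle_trans y x z : wle x y -> wle y z -> wle x z.
Proof.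
move=> xy yz.
have [|t tE lt] := @wle_min [set t | [\/ t = x, t = y | t = z]].
  by exists x; exact: Or31.
have [tx ty tz] : [/\ wle t x, wle t y & wle t z].
  by split; apply: lt; [exact: Or31|exact: Or32|exact: Or33].
case: tE => E; move: tx ty tz; rewrite E => tx ty tz //.
- by rewrite (wle_anti xy tx).
- by rewrite -(wle_anti yz ty).
Qed.

Lemma wle_wlt_trans y x z : wle x y -> wlt y z -> wlt x z.
Proof.
move=> xy [yz nyz]; split; first exact: wle_trans yz.
by move=> E; apply: nyz; apply: wle_anti => //; rewrite -E.
Qed.

Lemma wle_eqVlt x y : wle x y -> x = y \/ wlt x y.
Proof. by move=> xy; have [->|] := pselect (x = y); [left|right]. Qed.

Lemma wltNge x y : wlt x y <-> ~ wle y x.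
Proof.
split=> [[xy nxy] yx|nyx]; first exact/nxy/wle_anti.
have xy : wle x y by case: (wle_total x y).
by split=> // E; apply: nyx; rewrite E wle_refl.
Qed.

Lemma wlt_wf : well_founded (@wlt w).
Proof.
move=> x; apply: contrapT => nx.
have [|z nz lz] := @wle_min [set t | ~ Acc (@wlt w) t]; first by exists x.
apply: nz; constructor => y yz; apply: contrapT => ny.
exact: (wltNge _ _).1 yz (lz _ ny).
Qed.

Definition seg x : set w := [set y | wlt y x].

Definition is_max P x := P x /\ forall y, P y -> wle y x.

Lemma is_max_uniq P x y : is_max P x -> is_max P y -> x = y.
Proof. by move=> [Px lx] [Py ly]; apply: wle_anti; [apply: ly|apply: lx]. Qed.

End wotype_theory.

Section osub.
Context (w : wotype) (P : set w).

Let osub_wo : wochoice.well_order (fun x y : {x | P x} => wle (sval x) (sval y)).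
Proof.
move=> A [[x Px] Ax].
have [|z [Pz Az] lz] := @wle_min w [set z | exists h : P z, exist _ z h \in A].
  by exists x, Px.
exists (exist _ z Pz); split.
  by split=> // -[y Py] Ay; apply: lz; exists Py.
move=> [y Py] [Ay ly]; apply: eq_exist => /=; apply: wle_anti.
  by apply: lz; exists Py.
exact: (ly _ Az).
Qed.

Definition osub := Wotype osub_wo.
End osub.

Definition oseg (w : wotype) (x : w) : wotype := osub (seg x).

Section osucc.
Context (w : wotype).

Definition osucc_le (x y : option w) :=
  match x, y with
  | Some x, Some y => wle x y
  | _, None => true
  | None, Some _ => false
  end.

Let osucc_wo : wochoice.well_order osucc_le.
Proof.
move=> A [a Aa].
have [[x Ax]|nA] := pselect (exists x, Some x \in A).
  have [|z Az lz] := @wle_min w [set z | Some z \in A]; first by exists x.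
  exists (Some z); split; first by split=> // -[y|] // /lz.
  move=> [y|] [Ay ly]; last by have := ly _ Az.
  by congr Some; apply: wle_anti; [exact: lz|exact: (ly _ Az)].
have nS y : Some y \in A -> False by move=> ?; apply: nA; exists y.
case: a Aa => [a /nS//|A0]; exists None; split.
  by split=> // -[y /nS|].
by move=> [y [/nS]|].
Qed.

(* alpha + 1: [None] is the new last element *)
Definition osucc := Wotype osucc_wo.
End osucc.

(* the predecessor of a successor ordinal, i.e. the segment below the last
   element; [w] itself when there is no last element *)
Definition opred (w : wotype) : wotype :=
  match pselect (exists x, is_max [set: w] x) with
  | left h => oseg (sval (cid h))
  | right _ => w
  end.

Definition initial_embedding (v w : wotype) (f : v -> w) : Prop :=
  (forall x y, wle (f x) (f y) = wle x y) /\
  (forall x y, wle y (f x) -> range f y).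

Definition ord_le (v w : wotype) : Prop :=
  exists f : v -> w, initial_embedding f.

Definition ord_lt (v w : wotype) : Prop :=
  exists2 f : v -> w, initial_embedding f & exists x, range f = seg x.

Section cantor_bendixson.
Context (S : topologicalType).

(* the accumulation points of the subspace A *)
Definition derived (A : set S) : set S := A `&` limit_point A.

(* Value at the ordinal of an initial segment P of w, given the values D at the
   elements of P: P = {..., m} has a last element m at successors; otherwise P
   is a limit, or empty, in which case the intersection is S itself. *)
Definition cb_step (w : wotype) (P : set w) (D : w -> set S) : set S :=
  match pselect (exists m, is_max P m) with
  | left h => derived (D (sval (cid h)))
  | right _ => \bigcap_(x in P) D x
  end.

(* the derivatives of S at the ordinals of the elements of w *)
Definition cb_at (w : wotype) : w -> set S :=
  Fix (@wlt_wf w) (fun=> set S) (fun x D =>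
    cb_step (seg x) (fun y => [set s | exists yx : wlt y x, D y yx s])).

Definition cb (w : wotype) : set S := cb_step [set: w] (@cb_at w).

Lemma eq_cb_step (w : wotype) (P : set w) (D E : w -> set S) :
  (forall x, P x -> D x = E x) -> cb_step P D = cb_step P E.
Proof.
move=> DE; rewrite /cb_step; case: pselect => [h|_].
  by rewrite DE//; case: cid => m [].
by apply: eq_bigcapr.
Qed.

Lemma cb_atE (w : wotype) (x : w) : cb_at x = cb_step (seg x) (@cb_at w).
Proof.
rewrite {1}/cb_at Fix_eq.
  apply: eq_cb_step => y yx; apply/seteqP; split=> s /=; last by exists yx.
  by case.
move=> y f g fg; congr (cb_step _ _); apply/funext => z.
by apply/seteqP; split=> s [h]; exists h; rewrite ?fg// -fg.
Qed.

Lemma cb_step_max (w : wotype) (P : set w) (D : w -> set S) m :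
  is_max P m -> cb_step P D = derived (D m).
Proof.
move=> Pm; rewrite /cb_step; case: pselect => [h|[]]; last by exists m.
by case: cid => n /= Pn; rewrite (is_max_uniq Pn Pm).
Qed.

Lemma cb_step_lim (w : wotype) (P : set w) (D : w -> set S) :
  ~ (exists m, is_max P m) -> cb_step P D = \bigcap_(x in P) D x.
Proof. by rewrite /cb_step; case: pselect. Qed.

Lemma cb_step_emb (v w : wotype) (f : v -> w) (P : set v) D :
  initial_embedding f -> cb_step P (D \o f) = cb_step (f @` P) D.
Proof.
move=> [fle fdn].
have [[m [Pm lm]]|nP] := pselect (exists m, is_max P m).
  rewrite (@cb_step_max _ P _ m)// (@cb_step_max _ (f @` P) _ (f m))//.
  by split; [exists m|move=> _ [y Py <-]; rewrite fle; exact: lm].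
rewrite !cb_step_lim ?bigcap_image//.
move=> [_ [[m Pm <-] lm]]; apply: nP; exists m; split=> // y Py.
by rewrite -fle; apply: lm; exists y.
Qed.

Lemma initial_embedding_inj (v w : wotype) (f : v -> w) :
  initial_embedding f -> injective f.
Proof.
by move=> [fle _] x y E; apply: wle_anti; rewrite -fle E wle_refl.
Qed.

Lemma initial_embedding_seg (v w : wotype) (f : v -> w) (x : v) :
  initial_embedding f -> f @` seg x = seg (f x).
Proof.
move=> fE; have fI := initial_embedding_inj fE; case: (fE) => fle fdn.
apply/seteqP; split=> [_ [y [yx nyx] <-]|z [zx nzx]].
  by split; [rewrite fle|move/fI].
have [y _ yE] := fdn _ _ zx; exists y => //; split; first by rewrite -fle yE.
by move=> E; apply: nzx; rewrite -yE E.
Qed.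

Lemma cb_at_emb (v w : wotype) (f : v -> w) (x : v) :
  initial_embedding f -> cb_at (f x) = cb_at x.
Proof.
move=> fE; elim/(well_founded_ind (@wlt_wf v)) : x => x IH.
rewrite cb_atE -(initial_embedding_seg x fE) -cb_step_emb// [RHS]cb_atE.
exact: eq_cb_step.
Qed.

Lemma cb_emb (v w : wotype) (f : v -> w) :
  initial_embedding f -> cb v = cb_step (range f) (@cb_at w).
Proof.
move=> fE; rewrite -cb_step_emb//; apply: eq_cb_step => x _ /=.
by rewrite cb_at_emb.
Qed.

Lemma initial_embedding_oseg (w : wotype) (x : w) :
  initial_embedding (sval : oseg x -> w) /\
  range (sval : oseg x -> w) = seg x.
Proof.
split; first split=> [//|[y yx] z zy].
  have zx : seg x z by exact: (wle_wlt_trans zy yx).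
  by exists (exist _ z zx).
apply/seteqP; split=> [_ [[y yx] _ <-]//|y yx].
by exists (exist _ y yx).
Qed.

Lemma cb_oseg (w : wotype) (x : w) : cb (oseg x) = cb_at x.
Proof.
have [sE sR] := initial_embedding_oseg x.
by rewrite (cb_emb sE) sR -cb_atE.
Qed.

Lemma cb_lt (v w : wotype) (f : v -> w) x :
  initial_embedding f -> range f = seg x -> cb v = cb_at x.
Proof. by move=> fE fx; rewrite (cb_emb fE) fx -cb_atE. Qed.

Lemma initial_embedding_Some (w : wotype) :
  initial_embedding (Some : w -> osucc w) /\
  range (Some : w -> osucc w) = seg (None : osucc w).
Proof.
split; first by split=> // x [y|]//= _; exists y.
by apply/seteqP; split=> [_ [x _ <-] //|[x|] [] //]; exists x.
Qed.

Lemma cb_None (w : wotype) : cb w = cb_at (None : osucc w).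
Proof.
by have [sE sR] := initial_embedding_Some w; rewrite (cb_emb sE) sR -cb_atE.
Qed.

Lemma cb_zero (w : wotype) : (w -> False) -> cb w = [set: S].
Proof.
move=> w0; rewrite /cb cb_step_lim; last by case=> x; case: (w0 x).
by apply/seteqP; split=> // s _ x; case: (w0 x).
Qed.

Lemma cb_succ (w : wotype) : cb (osucc w) = derived (cb w).
Proof.
rewrite {1}/cb (@cb_step_max _ _ _ (None : osucc w)) ?cb_None//.
by split=> // -[].
Qed.

Lemma cb_opred (w : wotype) : cb (opred (osucc w)) = cb w.
Proof.
rewrite /opred; case: pselect => [h|[]]; last by exists None; split=> // -[].
have -> : sval (cid h) = None.
  by apply: (is_max_uniq (svalP (cid h))); split=> // -[].
by rewrite cb_oseg cb_None.
Qed.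

Lemma cb_lim (w : wotype) : ~ (exists m, is_max [set: w] m) ->
  cb w = [set s | forall v, ord_lt v w -> cb v s].
Proof.
move=> wl; rewrite {1}/cb cb_step_lim//; apply/seteqP; split=> s /= H.
  by move=> v [f fE [x fx]]; rewrite (cb_lt fE fx); exact: H.
move=> x _; rewrite -cb_oseg; apply: H.
by have [sE sR] := initial_embedding_oseg x; exists sval => //; exists x.
Qed.

Lemma cb_at_anti (w : wotype) (x y : w) : wle x y -> cb_at y `<=` cb_at x.
Proof.
elim/(well_founded_ind (@wlt_wf w)) : y => y IH /wle_eqVlt[->//|xy].
rewrite (cb_atE y).
have [[m Pm]|nP] := pselect (exists m, is_max (seg y) m); last first.
  by rewrite cb_step_lim// => s; exact.
rewrite (cb_step_max _ Pm); case: Pm => my lm.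
by move=> s [+ _]; apply: IH => //; exact: lm.
Qed.

Lemma cb_at_lt (w : wotype) (x y : w) : wlt x y -> cb_at y `<=` derived (cb_at x).
Proof.
elim/(well_founded_ind (@wlt_wf w)) : y => y IH xy.
have [[m Pm]|nP] := pselect (exists m, is_max (seg y) m).
  rewrite (cb_atE y) (cb_step_max _ Pm); case: Pm => my lm.
  have [->//|xm] := wle_eqVlt (lm _ xy).
  by move=> s [+ _]; exact: IH.
have [z [zy xz]] : exists z, wlt z y /\ wlt x z.
  apply: contrapT => nz; apply: nP; exists x; split=> // z zy.
  by apply: contrapT => /wltNge xz; apply: nz; exists z.
by apply: subset_trans (IH _ zy xz); apply: cb_at_anti; case: zy.
Qed.

Lemma cb_at_stable (w : wotype) (x y : w) : wle x y ->
  derived (cb_at x) = cb_at x -> cb_at y = cb_at x.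
Proof.
move=> + dx; elim/(well_founded_ind (@wlt_wf w)) : y => y IH.
move=> /[dup] lexy /wle_eqVlt[->//|xy].
have [[m Pm]|nP] := pselect (exists m, is_max (seg y) m).
  rewrite (cb_atE y) (cb_step_max _ Pm); case: Pm => my lm.
  by rewrite IH//; exact: lm.
apply/seteqP; split; first exact: cb_at_anti.
rewrite (cb_atE y) cb_step_lim// => s xs z zy.
have [xz|zx] := wle_total x z; first by rewrite IH.
exact: (cb_at_anti zx).
Qed.

End cantor_bendixson.

Arguments cb S w : clear implicits.
Arguments cb_at S {w} x.

Section perfect_kernel.
Context (S : topologicalType).

Definition eventually_cb (A : set S) : Prop :=
  exists v, forall w, ord_le v w -> cb S w = A.

Lemma eventually_cb_ex : exists A, eventually_cb A.
Proof.
have [r r_wo] := @wochoice.well_ordering_principle {classic (set S)}.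
pose w := Wotype r_wo.
have [x dx] : exists x : w, derived (cb_at S x) = cb_at S x.
  apply: contrapT => nx.
  have ex (x : w) : exists s, cb_at S x s /\ ~ derived (cb_at S x) s.
    apply: contrapT => ns; apply: nx; exists x.
    apply/seteqP; split; first by move=> s [].
    by move=> s xs; apply: contrapT => nds; apply: ns; exists s.
  have [f fP] := choice ex.
  have f_lt (x y : w) : wlt x y -> f x <> f y.
    move=> xy E; have [_] := fP x; apply; rewrite E.
    by apply: (cb_at_lt xy); case: (fP y).
  have f_inj : injective f.
    move=> x y E; apply: contrapT => nxy.
    have [/wle_eqVlt[//|/f_lt//]|/wle_eqVlt[/esym//|/f_lt]] := wle_total x y.
    exact.
  pose D : set S := [set s | exists2 A : set S, f A = s & ~ A s].
  have [DfD|nDfD] := pselect (D (f D)); last by apply: (nDfD); exists D.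
  by case: (DfD) => A /f_inj ->.
exists (cb_at S x), (oseg x) => v [f fE].
have [sE sR] := initial_embedding_Some v.
have gE : initial_embedding (Some \o f : oseg x -> osucc v).
  case: fE sE => fle fdn [sle sdn]; split=> [a b|a b] /=.
    by rewrite fle.
  by case: b => //= b /fdn[c _ <-]; exists c.
have [[u gu]|ng] := pselect (exists u, range (Some \o f) = seg (u : osucc v)).
  have xu : cb_at S u = cb_at S x by rewrite -(cb_lt S gE gu) cb_oseg.
  by rewrite cb_None -xu; apply: cb_at_stable; [case: u {gu xu}|rewrite xu].
exfalso; apply: ng.
have [|u ru lu] := @wle_min (osucc v) (~` range (Some \o f)).
  by exists None => -[].
exists u; apply/seteqP; split=> [_ [a _ <-]|a au].
  by apply/wltNge => /(gE.2 a u).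
by apply: contrapT => /lu; exact/wltNge.
Qed.

(* the perfect kernel *)
Definition perfect_kernel : set S := sval (cid eventually_cb_ex).

Definition scattered : Prop := perfect_kernel = set0.

Definition is_height (v : wotype) : Prop :=
  cb S v = set0 /\ forall w, ord_lt w v -> cb S w <> set0.

Lemma is_height_ex : scattered -> exists v, is_height v.
Proof.
rewrite /scattered /perfect_kernel; case: cid => /= A [w wP] A0.
have /wP : ord_le w w by exists id; split=> // x y _; exists y.
rewrite A0 cb_None => w0.
have [|z z0 lz] := @wle_min (osucc w) [set z | cb_at S z = set0].
  by exists None.
exists (oseg z); split; first by rewrite cb_oseg.
move=> v [f fE [u fu]]; rewrite (cb_lt S fE fu).
have [sE sR] := initial_embedding_oseg z.
rewrite -(cb_at_emb S u sE) => /lz.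
by apply/wltNge; case: u {fu}.
Qed.

Definition height (sS : scattered) : wotype := sval (cid (is_height_ex sS)).

(* [None] is infinity *)
Definition ht : option wotype :=
  match pselect scattered with
  | left sS => Some (height sS)
  | right _ => None
  end.

End perfect_kernel.

Definition ht_le (a b : option wotype) : Prop :=
  match a, b with
  | _, None => True
  | None, Some _ => False
  | Some v, Some w => ord_le v w
  end.

(* Main.v *)
(* (vi) => (iii): let |T f| <= a for |f| <= 1, and let |T f| > c, with c > a,
   for |f| >= 3.  If f = 1 on a neighbourhood U of x in L^(al) and |f| <= 1,
   then for every bump h inside U some y satisfies |T (f + 2 h) y| > c, and
   T f y <> 0 since |f - 2 h| <= 1.  These y accumulate in K^(al).  Otherwise,
   at a successor al = be + 1, their closure meets K^(be) in a finite set t,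
   and among many disjointly supported plateau functions g around points of
   L^(be) in U one has T g small on t; taking h inside the plateau of g,
   |f + 2 h - 2 g| <= 1 although |T (f + 2 h - 2 g)| > a near t.  So a
   combination of plateau functions around n points of L^(al) cannot vanish
   on K^(al) under T, and linear algebra gives n points in K^(al).

   Conversely, such finite comparisons of derivatives suffice for (ii) and (v).
   They let one build a binary tree of closed sets U_s covering L, of diameter
   tending to 0, and of open sets V_s of K with disjoint closures, together
   with continuous th_s : K -> [0, 1] equal to 0 and 1 on the closures of the
   two children of V_s.  A point y of K then describes a random branch (th_s y
   is the probability of turning to the second child), hence a random point of
   L, and T f y is the expectation of f at that point.  Each x in L is the
   deterministic limit of the branch of some y, so T is a positive isometry,
   and the set of those y is closed and maps onto L. *)
From HB Require Import structures.
Require Import Defs.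
From mathcomp Require Import all_boot all_order all_algebra.
From mathcomp Require Import all_classical all_reals all_analysis.
From mathcomp Require Import ring lra.

Set Implicit Arguments.
Unset Strict Implicit.
Unset Printing Implicit Defensive.

Import Order.TTheory GRing.Theory Num.Theory.
Import numFieldNormedType.Exports.

Local Open Scope classical_set_scope.
Local Open Scope card_scope.
Local Open Scope ring_scope.

(** * Ordinals and Cantor-Bendixson derivatives *)

Section ordinals.
Implicit Types v w : wotype.

Lemma wltW w (x y : w) : wlt x y -> wle x y. Proof. by case. Qed.

Lemma wlt_total w (x y : w) : [\/ wlt x y, x = y | wlt y x].
Proof.
have [/wle_eqVlt[->|]|/wle_eqVlt[->|]] := wle_total x y.
- exact: Or32.
- exact: Or31.
- exact: Or32.
- exact: Or33.
Qed.

(** Composed with [Some], the embedding misses [None]; the least missed element is the one whose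
    segment is the range. *)
Lemma ord_le_lt_osucc v w : ord_le v w -> ord_lt v (osucc w).
Proof.
move=> [f [fle fdn]].
have gE : initial_embedding (Some \o f : v -> osucc w).
  split=> [a b|a b] /=; first by rewrite -fle.
  by case: b => //= b /fdn[c _ <-]; exists c.
exists (Some \o f) => //.
have [|u ru lu] := @wle_min (osucc w) (~` range (Some \o f)).
  by exists None => -[].
exists u; apply/seteqP; split=> [_ [a _ <-]|a au].
  by apply/wltNge => /(gE.2 a u).
by apply: contrapT => /lu; exact/wltNge.
Qed.

Lemma ord_le_osucc w : ord_le w (osucc w).
Proof. by have [sE _] := initial_embedding_Some w; exists Some. Qed.

Lemma ord_lt_oseg w (x : w) : ord_lt (oseg x) w.
Proof.
have [sE sR] := initial_embedding_oseg x.
by exists sval => //; exists x.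
Qed.

(* Comparison map: g x is the least element of w outside g @` seg x, and None
   once w is exhausted. *)
Lemma comparison_map v w : exists g : v -> option w, forall x,
  (forall z, g x = Some z -> ~ (g @` seg x) (Some z) /\
     forall z', ~ (g @` seg x) (Some z') -> wle z z') /\
  (g x = None -> forall z, (g @` seg x) (Some z)).
Proof.
have /choice[m mP] : forall P : set (option w), exists o : option w,
    (forall z, o = Some z -> ~ P (Some z) /\
       forall z', ~ P (Some z') -> wle z z') /\
    (o = None -> forall z, P (Some z)).
  move=> P; have [h|h] := pselect (exists z, ~ P (Some z)).
    have [z nPz lz] := @wle_min w [set z | ~ P (Some z)] h.
    by exists (Some z); split=> // _ [<-].
  by exists None; split=> // _ z; apply: contrapT => nz; apply: h; exists z.
pose step (x : v) (D : forall y, wlt y x -> option w) :=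
  m [set s | exists y (yx : wlt y x), D y yx = s].
pose g : v -> option w := Fix (@wlt_wf v) (fun=> option w) step.
have gE x : g x = m (g @` seg x).
  rewrite {1}/g Fix_eq; last first.
    move=> y a b ab; congr m; apply/seteqP.
    by split=> s [z [h <-]]; exists z, h; rewrite ab.
  congr m; apply/seteqP; split=> [s [z [h <-]]|_ [z h <-]]; first by exists z.
  by exists z, h.
by exists g => x; rewrite gE; exact: mP.
Qed.

(** If the comparison map never takes the value [None], it embeds [v] as an initial segment of [w].
    Otherwise, at the least [x] with value [None], it maps [seg x] bijectively onto [w], and the
    inverse embeds [w] strictly below [v]. *)
Lemma ord_le_or_lt v w : ord_le v w \/ ord_lt w v.
Proof.
have [g gP] := comparison_map v w.
have g_lt x y a b : wlt x y -> g x = Some a -> g y = Some b -> wlt a b.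
  move=> xy gx gy; have [ny _] := (gP y).1 _ gy.
  have [_ lx] := (gP x).1 _ gx; split.
    apply: lx => -[z zx gz]; apply: ny; exists z => //.
    exact: wle_wlt_trans (wltW zx) xy.
  by move=> ab; apply: ny; exists x => //; rewrite gx ab.
have g_le x y a b : g x = Some a -> g y = Some b -> wle a b = wle x y.
  move=> gx gy; have [xy|xy|yx] := wlt_total x y.
  - by rewrite (wltW xy) (wltW (g_lt _ _ _ _ xy gx gy)).
  - by move: gx; rewrite xy gy => -[->]; rewrite !wle_refl.
  - have /wltNge/negP/negbTE -> := g_lt _ _ _ _ yx gy gx.
    by have /wltNge/negP/negbTE -> := yx.
have [nN|/existsNP[x0 /contrapT gx0]] := pselect (forall x, g x <> None).
  left; have /choice[f fE] : forall x, exists z, g x = Some z.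
    by move=> x; case E : (g x) (nN x) => [z|//] _; exists z.
  exists f; split=> [x y|x y yx]; first exact: g_le.
  have [[z zx]|ny] := pselect ((g @` seg x) (Some y)).
    by rewrite fE => -[<-]; exists z.
  exists x => //; apply: wle_anti (yx); exact: ((gP x).1 _ (fE x)).2.
right; have [x gx lx] := @wle_min v [set x | g x = None] (ex_intro _ x0 gx0).
have /choice[h hP] : forall z, exists y, wlt y x /\ g y = Some z.
  by move=> z; have [y yx gy] := (gP x).2 gx z; exists y.
have hle a b : wle (h a) (h b) = wle a b.
  by have [_ ha] := hP a; have [_ hb] := hP b; rewrite (g_le _ _ _ _ ha hb).
have hR y : wlt y x -> range h y.
  move=> yx; case E : (g y) => [z|]; last by have /wltNge := yx; case;
    exact: lx.
  exists z => //; have [_ hz] := hP z.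
  by apply: wle_anti;
    rewrite -?(g_le _ _ _ _ hz E) -?(g_le _ _ _ _ E hz) wle_refl.
exists h; last first.
  by exists x; apply/seteqP; split=> [_ [z _ <-]|y /hR//]; have [] := hP z.
split=> [a b|a b ba]; first exact: hle.
by apply: hR; apply: wle_wlt_trans ba _; have [] := hP a.
Qed.

End ordinals.

Section derivatives.
Context (S : topologicalType).
Implicit Types (A U : set S) (v w : wotype).

(** Both ordinals sit inside [osucc w], so derivatives along different well-orders are compared as
    values of one [cb_at]. *)
Lemma cb_anti v w : ord_le v w -> cb S w `<=` cb S v.
Proof.
move=> /ord_le_lt_osucc[f fE [x fx]].
by rewrite (cb_lt S fE fx) cb_None; apply: cb_at_anti; case: x {fx}.
Qed.

Lemma cb_lt_derived v w : ord_lt v w -> cb S w `<=` derived (cb S v).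
Proof.
move=> [f fE [x fx]]; rewrite (cb_lt S fE fx) cb_None.
have [sE _] := initial_embedding_Some w.
by rewrite -(cb_at_emb S x sE); apply: cb_at_lt.
Qed.

Lemma cb_perfect_kernel : exists w, cb S w = @perfect_kernel S.
Proof.
rewrite /perfect_kernel; case: cid => /= A [w wP]; exists w; apply: wP.
by exists id; split=> // x y _; exists y.
Qed.

Lemma perfect_kernel_sub v : @perfect_kernel S `<=` cb S v.
Proof.
rewrite /perfect_kernel; case: cid => /= A [w wP].
have [wv|/cb_lt_derived vw] := ord_le_or_lt w v; first by rewrite wP.
rewrite -(wP w); last by exists id; split=> // x y _; exists y.
by apply: subset_trans vw _ => x [].
Qed.

Lemma derived_perfect_kernel : derived (@perfect_kernel S) = @perfect_kernel S.
Proof.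
rewrite /perfect_kernel; case: cid => /= A [w wP].
rewrite -{1}(wP w); last by exists id; split=> // x y _; exists y.
by rewrite -cb_succ wP//; exact: ord_le_osucc.
Qed.

Hypothesis hS : hausdorff_space S.

Lemma closed_derived A : closed A -> closed (derived A).
Proof.
move=> cA; apply: closedI => //.
by apply: limit_point_closed; exact: hausdorff_accessible.
Qed.

Lemma closed_cb_at w (x : w) : closed (cb_at S x).
Proof.
elim/(well_founded_ind (@wlt_wf w)) : x => x IH; rewrite cb_atE.
have [[m mP]|nm] := pselect (exists m, is_max (seg x) m).
  by rewrite (cb_step_max _ mP); apply: closed_derived; apply: IH; case: mP.
by rewrite cb_step_lim//; apply: closed_bigI => y; exact: IH.
Qed.

(** Counting up to a finite [n] replaces cardinality: this much is what an operator of small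
    distortion yields, and it suffices to build the tree. *)
Definition atleast (n : nat) A :=
  exists s : seq S, [/\ uniq s, size s = n & {in s, forall x, A x}].

Lemma atleast0 A : atleast 0 A.
Proof. by exists [::]; split=> // x; rewrite in_nil. Qed.

Lemma atleast_set0 n : atleast n (@set0 S) -> n = 0%N.
Proof.
by move=> [[|x s] [_ <- // s0]]; have := s0 x; rewrite mem_head => /(_ isT).
Qed.

Lemma atleast1 A : atleast 1 A <-> A !=set0.
Proof.
split=> [[[|x s] [_ // _ sA]]|[x Ax]].
  by exists x; apply: sA; rewrite mem_head.
by exists [:: x]; split=> // y; rewrite inE => /eqP ->.
Qed.

Lemma sub_atleast A U n : A `<=` U -> atleast n A -> atleast n U.
Proof. by move=> AU [s [us ss sA]]; exists s; split=> // x /sA /AU. Qed.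

Lemma leq_atleast A m n : (m <= n)%N -> atleast n A -> atleast m A.
Proof.
move=> mn [s [us ss sA]]; exists (take m s); split.
- exact: take_uniq.
- by rewrite size_takel// ss.
- by move=> x /mem_take /sA.
Qed.

Lemma atleast_notin A (t : seq S) n :
  atleast (size t + n) A -> atleast n (A `&` [set x | x \notin t]).
Proof.
move=> [s [us ss sA]]; pose r := [seq x <- s | x \notin t].
apply: (@leq_atleast _ _ (size r)); last first.
  exists r; split=> //; first exact: filter_uniq.
  by move=> x; rewrite mem_filter => /andP[xt /sA].
rewrite -(leq_add2l (size t)) -ss /r size_filter.
rewrite -[X in (X <= _)%N](count_predC (mem t) s) leq_add2r.
rewrite -size_filter uniq_leq_size ?filter_uniq// => x.
by rewrite mem_filter => /andP[].
Qed.

Lemma natleast A n : ~ atleast n A ->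
  exists t : seq S, [/\ uniq t, (size t < n)%N & A = [set` t]].
Proof.
elim: n => [|n IH] nA; first by case: nA; exact: atleast0.
have [An|/IH[t [ut st At]]] := pselect (atleast n A); last first.
  by exists t; split=> //; exact: ltnW.
have [t [ut st tA]] := An; exists t; split=> //; first by rewrite st.
apply/seteqP; split=> x /=; last exact: tA.
move=> Ax; apply: contrapT => /negP xt; apply: nA.
exists (x :: t); split; rewrite /= ?xt ?st// => y.
by rewrite inE => /predU1P[->|/tA].
Qed.

(** Points found are removed one by one: since points are closed, what remains is still a
    neighbourhood of [x]. *)
Lemma derived_atleast A U x n : derived A x -> nbhs x U -> atleast n (U `&` A).
Proof.
move=> [_ lx]; elim: n U => [|n IH] U Ux; first exact: atleast0.
have [y [yx Ay Uy]] := lx _ Ux.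
have Wx : nbhs x (U `&` [set~ y]).
  apply: filterI => //; apply: open_nbhs_nbhs; split; last exact/nesym/eqP.
  by rewrite openC; apply: accessible_closed_set1; exact: hausdorff_accessible.
have [s [us ss sA]] := IH _ Wx; exists (y :: s); split=> /=.
- by rewrite us andbT; apply/negP => /sA[[_ /=]].
- by rewrite ss.
- by move=> z; rewrite inE => /predU1P[->//|/sA[[]]].
Qed.

Lemma heightP (sS : scattered S) : is_height S (height sS).
Proof. by rewrite /height; case: cid. Qed.

End derivatives.

(** * Plateau functions *)

Lemma atleastP (S : topologicalType) n (A : set S) : atleast n A ->
  exists2 p : 'I_n -> S, injective p & forall i, A (p i).
Proof.
move=> [s [us /eqP ss sA]]; exists (tnth (Tuple ss)); first exact/tuple_uniqP.
by move=> i; apply: sA; exact: mem_tnth.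
Qed.

Section compactness.
Context (S : topologicalType).

(** The finite intersection property for a decreasing chain, which carries the transfinite
    inductions through limit stages. Nonemptiness of [A] covers an empty [P], that is, stage
    zero. *)
Lemma compact_chain (w : wotype) (P : set w) (D : w -> set S) (A : set S) :
  compact A -> A !=set0 -> (forall x, closed (D x)) ->
  (forall x y, wle x y -> D y `<=` D x) ->
  (forall x, P x -> A `&` D x !=set0) ->
  A `&` \bigcap_(x in P) D x !=set0.
Proof.
move=> cA [a Aa] cD Danti AD.
have [[x0 Px0]|nP] := pselect (P !=set0); last first.
  by exists a; split=> // x Px; case: nP; exists x.
pose F := filter_from P (fun x => A `&` D x).
have FF : ProperFilter F.
  apply: filter_from_proper => //.
  apply: filter_from_filter; first by exists x0.
  move=> x y Px Py; have [xy|yx] := wle_total x y.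
    by exists y => // z [Az Dz]; split; split=> //; apply: Danti Dz.
  by exists x => // z [Az Dz]; split; split=> //; apply: Danti Dz.
have [|z [Az Fz]] := cA F; first by exists x0 => // z [].
exists z; split=> // x Px; apply: cD => W Wz.
have [|t [Dt Wt]] := Fz (D x) W _ Wz; last by exists t.
by exists x => // t [].
Qed.

(** If [A] were infinite, the complements in [A] of finite sets would form a proper filter, and any
    cluster point of it would be an accumulation point of [A]. *)
Lemma compact_no_limit (A : set S) : compact A -> derived A = set0 ->
  exists t : seq S, A `<=` [set` t].
Proof.
move=> cA dA; apply: contrapT => nt.
pose F := filter_from [set: seq S] (fun t => A `\` [set` t]).
have FF : ProperFilter F.
  apply: filter_from_proper; last first.
    move=> t _; apply: contrapT => At; apply: nt; exists t => x Ax.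
    by apply: contrapT => xt; apply: At; exists x.
  apply: filter_from_filter; first by exists [::].
  move=> s t _ _; exists (s ++ t) => // x [Ax] /=; rewrite mem_cat => /negP.
  by rewrite negb_or => /andP[/negP ? /negP ?].
have [|z [Az Fz]] := cA F; first by exists [::] => // x [].
suff : derived A z by rewrite dA.
split=> // U Uz; have [|y [[Ay yz] Uy]] := Fz (A `\` [set` [:: z]]) U _ Uz.
  by exists [:: z].
by exists y; split=> //; apply/negP; move: yz; rewrite /= inE.
Qed.

End compactness.

Lemma norm_lt_nbhs (R : realType) (S : topologicalType) (f : S -> R) y e :
  {for y, continuous f} -> `|f y| < e -> nbhs y [set z | `|f z| < e].
Proof.
by move=> fy fe; exact: (@cvgr_norm_lt _ R^o _ _ _ _ _ fy).
Qed.

Lemma clamp_continuous (R : realType) (S : topologicalType) (f : S -> R) :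
  continuous f -> continuous (fun x => Num.min 1 (Num.max 0 (f x)) : R).
Proof.
move=> cf; have cst (a : R) : continuous (fun _ : S => a).
  by move=> x; exact: cvg_cst.
exact: (min_fun_continuous (cst 1) (max_fun_continuous (cst 0) cf)).
Qed.

Section cspaceE.
Context (R : realType) (S : topologicalType) (cS : compact [set: S]).
Local Notation C := (cspace R cS).
Implicit Types (f g : C).

Lemma cspace_ofE (h : S -> R) (ch : continuous h) x : cspace_of cS ch x = h x.
Proof. by []. Qed.

Lemma cspaceD f g x : cspace_fun (f + g) x = f x + g x. Proof. by []. Qed.
Lemma cspaceB f g x : cspace_fun (f - g) x = f x - g x. Proof. by []. Qed.
Lemma cspaceZ (a : R) f x : cspace_fun (a *: f) x = a * f x. Proof. by []. Qed.

Lemma cspace_sum I (r : seq I) (P : pred I) (F : I -> C) x :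
  cspace_fun (\sum_(i <- r | P i) F i) x = \sum_(i <- r | P i) F i x.
Proof. exact: (big_morph (fun f : C => cspace_fun f x)). Qed.

Lemma cspace_norm_le f x : `|f x| <= `|f|.
Proof. exact: le_supnorm. Qed.

Lemma cspace_norm_leP f (M : R) : 0 <= M ->
  (forall x, `|f x| <= M) -> `|f| <= M.
Proof. exact: supnorm_le. Qed.

End cspaceE.

Section plateaus.
Context (R : realType) (L : metricType R) (cL : compact [set: L]).
Local Notation C := (cspace R cL).

Lemma mdist_continuous (x : L) : continuous (mdist x : L -> R).
Proof.
move=> y; apply/cvgrPdist_lt => e e0.
have : nbhs y (ball y e) by exact: nbhsx_ballx.
apply: filterS => z; rewrite ballEmdist/= => yz.
rewrite (le_lt_trans _ yz)// ler_norml; apply/andP; split.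
  by have := metric_triangle x y z; lra.
by have := metric_triangle x z y; rewrite (metric_sym z y); lra.
Qed.

Lemma plateau (x : L) (U : set L) : nbhs x U -> exists (g : C) (V : set L),
  [/\ open V, V x, forall z, 0 <= g z <= 1, forall z, ~ U z -> g z = 0 &
      forall z, V z -> g z = 1].
Proof.
move=> /nbhs_ballP[r /= r0 xU].
(* The slope is chosen so that the unclamped function is at least 1 within distance r / 2 of [x] and
   at most 0 beyond r. *)
have cg : continuous
    (fun z : L => Num.min 1 (Num.max 0 (2 - 2 / r * mdist x z)) : R).
  apply: clamp_continuous => z; apply: cvgB; first exact: cvg_cst.
  by apply: cvgMl_tmp; exact: mdist_continuous.
exists (cspace_of cL cg), (ball x (r / 2))°; split.
- exact: open_interior.
- by apply: nbhsx_ballx; rewrite divr_gt0.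
- move=> z; rewrite cspace_ofE.
  by rewrite le_min ler01 ge_min lexx/= le_max lexx.
- move=> z nUz; rewrite cspace_ofE.
  have rz : r <= mdist x z.
    by rewrite leNgt; apply/negP => xz; apply: nUz; apply: xU;
      rewrite ballEmdist.
  have /max_idPl -> : 2 - 2 / r * mdist x z <= 0.
    by rewrite subr_le0 mulrAC ler_pdivlMr// ler_pM2l.
  by apply/min_idPr.
- move=> z /interior_subset; rewrite cspace_ofE ballEmdist => /= xz.
  have h : 1 <= 2 - 2 / r * mdist x z.
    rewrite lerBrDr -lerBrDl (_ : 2 - 1 = 1); last by lra.
    by rewrite mulrAC ler_pdivrMr//; lra.
  by apply/min_idPl; rewrite le_max h orbT.
Qed.

Lemma disjoint_plateaus n (p : 'I_n -> L) (U : set L) : injective p ->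
  (forall i, nbhs (p i) U) ->
  exists (g : 'I_n -> C) (V : 'I_n -> set L),
    (forall i, [/\ open (V i), V i (p i), forall z, 0 <= g i z <= 1,
        forall z, ~ U z -> g i z = 0 & forall z, V i z -> g i z = 1]) /\
    (forall i j z, i != j -> g i z = 0 \/ g j z = 0).
Proof.
move=> p_inj pU.
(* The least mutual distance of the points, capped at 1 so that it is also defined for fewer than
   two points. Balls of half this radius are disjoint. *)
pose r := \big[Num.min/1%R]_(ij : 'I_n * 'I_n | ij.1 != ij.2)
  mdist (p ij.1) (p ij.2).
have r0 : 0 < r.
  rewrite /r; apply: (big_ind (fun a => 0 < a)) => [//|a b a0 b0|[i j] /= ij].
    by rewrite lt_min a0.
  by rewrite mdist_gt0; apply: contra ij => /eqP/p_inj ->.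
have rp i j : i != j -> r <= mdist (p i) (p j).
  by move=> ij; rewrite /r (bigD1 (i, j))//= ge_min lexx.
have /choice[gV gVP] : forall i, exists gV : C * set L,
    [/\ open gV.2, gV.2 (p i), forall z, 0 <= gV.1 z <= 1,
      forall z, ~ (U `&` ball (p i) (r / 2)) z -> gV.1 z = 0 &
      forall z, gV.2 z -> gV.1 z = 1].
  move=> i; have [|g [V gVP]] := @plateau (p i) (U `&` ball (p i) (r / 2)).
    by apply: filterI => //; apply: nbhsx_ballx; rewrite divr_gt0.
  by exists (g, V).
exists (fst \o gV), (snd \o gV); split=> [i|i j z ij] /=.
  have [oV Vp g01 g0 g1] := gVP i; split=> // z nUz.
  by apply: g0 => -[].
have [[_ zi]|/(_ _)nzi] := pselect ((U `&` ball (p i) (r / 2)) z); last first.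
  by left; have [_ _ _ + _] := gVP i; apply.
right; have [_ _ _ + _] := gVP j; apply=> -[_ zj].
have := rp _ _ ij; move: zi zj; rewrite !ballEmdist/= => zi zj.
by have := metric_triangle (p i) z (p j); rewrite (metric_sym z); lra.
Qed.

(** At most one term of the sum is nonzero at [z]. *)
Lemma disjoint_comb_le n (g : 'I_n -> C) (u : 'I_n -> R) (M : R) z :
  0 <= M -> (forall i, `|u i| <= M) -> (forall i, 0 <= g i z <= 1) ->
  (forall i j, i != j -> g i z = 0 \/ g j z = 0) ->
  `|cspace_fun (\sum_(i < n) u i *: g i) z| <= M.
Proof.
move=> M0 uM g01 gd; rewrite cspace_sum.
have [[i gi]|ng] := pselect (exists i, g i z <> 0); last first.
  rewrite big1 ?normr0// => i _; rewrite cspaceZ.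
  suff -> : g i z = 0 by rewrite mulr0.
  by apply: contrapT => gi; apply: ng; exists i.
have -> : \sum_(j < n) cspace_fun (u j *: g j) z = u i * g i z.
  rewrite (bigD1 i isT) big1 => [|j ji]; first exact: addr0.
  by rewrite cspaceZ; case: (gd _ _ ji) => [->|//]; rewrite mulr0.
rewrite normrM; have /andP[gi0 gi1] := g01 i.
by rewrite (ger0_norm gi0) (le_trans _ (uM i))// ler_piMr.
Qed.

End plateaus.

(** * Embeddings of small distortion *)

Section small_distortion.
Context (R : realType) (L : metricType R) (K : topologicalType).
Context (cL : compact [set: L]) (cK : compact [set: K]).
Context (hK : hausdorff_space K).
Context (T : {linear cspace R cL -> cspace R cK}) (a c : R).
Hypothesis ac : a < c.
Hypothesis T_le : forall (f : cspace R cL) y,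
  (forall z, `|f z| <= 1) -> `|cspace_fun (T f) y| <= a.
Hypothesis T_gt : forall (f : cspace R cL) z,
  3 <= `|f z| -> exists y, c < `|cspace_fun (T f) y|.

Definition bump_in (U : set L) (h : cspace R cL) :=
  (forall z, 0 <= h z <= 1) /\ (forall z, ~ U z -> h z = 0).

(* The points where f + 2 h, of norm 3 when f = 1 on U, nearly attains it. *)
Definition peaks (f : cspace R cL) (U : set L) : set K :=
  [set y | exists2 h, bump_in U h & c < `|cspace_fun (T (f + 2 *: h)) y|].

Lemma sub_peaks f U V : V `<=` U -> peaks f V `<=` peaks f U.
Proof.
move=> VU y [h [h01 h0] hy]; exists h => //; split=> // z nUz.
by apply: h0 => /VU.
Qed.

Let T_affine f g (k : R) y :
  cspace_fun (T (f + k *: g)) y = cspace_fun (T f) y + k * cspace_fun (T g) y.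
Proof. by rewrite linearD linearZ. Qed.

Let T_sum n (g : 'I_n -> cspace R cL) (u : 'I_n -> R) y :
  cspace_fun (T (\sum_(i < n) u i *: g i)) y =
  \sum_(i < n) u i * cspace_fun (T (g i)) y.
Proof.
by rewrite linear_sum cspace_sum; apply: eq_bigr => i _; rewrite linearZ.
Qed.

(** With the signs of the [T (g i) y] as coefficients, the sum becomes the value at [y] of [T]
    applied to a single function bounded by 1. *)
Let T_sum_le n (g : 'I_n -> cspace R cL) y :
  (forall i z, 0 <= g i z <= 1) ->
  (forall i j z, i != j -> g i z = 0 \/ g j z = 0) ->
  \sum_(i < n) `|cspace_fun (T (g i)) y| <= a.
Proof.
move=> g01 gd; pose u i := Num.sg (cspace_fun (T (g i)) y).
have -> : \sum_(i < n) `|cspace_fun (T (g i)) y| =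
    cspace_fun (T (\sum_(i < n) u i *: g i)) y.
  by rewrite T_sum; apply: eq_bigr => i _; rewrite normrEsg.
apply: le_trans (ler_norm _) _; apply: T_le => z.
apply: disjoint_comb_le => // [i|i j]; last exact: gd.
by rewrite /u normr_sg lern1 leq_b1.
Qed.

(** Otherwise each [g i] contributes at least [d] at some point of [t]; summing over [i] and
    exchanging sums contradicts the bound [a] at each point of [t]. *)
Let exists_small n (g : 'I_n -> cspace R cL) (t : seq K) (d : R) :
  (forall i z, 0 <= g i z <= 1) ->
  (forall i j z, i != j -> g i z = 0 \/ g j z = 0) ->
  (size t)%:R * a < n%:R * d ->
  exists i, {in t, forall y, `|cspace_fun (T (g i)) y| < d}.
Proof.
move=> g01 gd nd; apply: contrapT => ni; move: nd; apply/negP; rewrite -leNgt.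
have big i : d <= \sum_(y <- t) `|cspace_fun (T (g i)) y|.
  have [y [yt dy]] : exists y, y \in t /\ d <= `|cspace_fun (T (g i)) y|.
    apply: contrapT => ny; apply: ni; exists i => y yt; rewrite ltNge.
    by apply/negP => dy; apply: ny; exists y.
  by rewrite (big_rem y)//= (le_trans dy)// lerDl sumr_ge0.
have -> : n%:R * d = \sum_(i < n) d by rewrite sumr_const card_ord mulr_natl.
apply: le_trans (ler_sum _ (fun i _ => big i)) _.
rewrite exchange_big /=.
have -> : (size t)%:R * a = \sum_(y <- t) a.
  by rewrite big_const_seq count_predT iter_addr_0 mulr_natl.
by apply: ler_sum => y _; exact: T_sum_le.
Qed.

Lemma peaks_cluster (w : wotype) (b : w) x (U : set L) (f : cspace R cL) :
  open U -> cb_at L b x -> U x ->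
  (forall z, `|f z| <= 1) -> (forall z, U z -> f z = 1) ->
  closure (peaks f U) `&` cb_at K b !=set0.
Proof.
move=> + + + f1; elim/(well_founded_ind (@wlt_wf w)) : b x U =>
  b IH x U oU bx Ux fU.
have cptP V : compact (closure (peaks f V)).
  by apply: subclosed_compact cK _ => //; exact: closed_closure.
have [[m mP]|nm] := pselect (exists m, is_max (seg b) m); last first.
  rewrite cb_atE cb_step_lim//; apply: compact_chain => //.
  (* A bump [h] equal to 1 at [x] makes f + 2 h equal to 3 there, so there are peaks; this alone
     settles the least [b], whose segment is empty. *)
  - have [h [V [oV Vx h01 h0 h1]]] :=
      @plateau _ _ cL x U (open_nbhs_nbhs (conj oU Ux)).
    have [|y yc] := @T_gt (f + 2 *: h) x.
      by rewrite cspaceD cspaceZ fU// h1// ger0_norm; lra.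
    by exists y; apply: subset_closure; exists h.
  - by move=> z; exact: closed_cb_at.
  - by move=> z z'; exact: cb_at_anti.
  - move=> z zb; apply: (IH z zb x) => //.
    by apply: (cb_at_anti (wltW zb)).
have [mb _] := mP; apply: contrapT => nP.
have [t Pt] : exists t : seq K, closure (peaks f U) `&` cb_at K m `<=` [set` t].
  apply: compact_no_limit.
    by apply: compact_closedI => //; exact: closed_cb_at.
  apply/seteqP; split=> // y [[Py my] ly]; apply: nP; exists y; split=> //.
  rewrite cb_atE (cb_step_max _ mP); split=> // W Wy.
  by have [z [zy [Pz mz] Wz]] := ly _ Wy; exists z.
(* The threshold satisfies a + 2 d = c, and [n] is taken large enough for [exists_small] to give a
   plateau function with image below [d] on all of [t]. *)
pose d := (c - a) / 2; have d0 : 0 < d by rewrite divr_gt0// subr_gt0.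
pose n := (Num.truncn ((size t)%:R * a / d)).+1.
have nd : (size t)%:R * a < n%:R * d.
  by rewrite -ltr_pdivrMr// /n truncnS_gt.
have [|p p_inj pP] := @atleastP _ n (U `&` cb_at L m).
  apply: (derived_atleast (@metric_hausdorff _ L) (x := x)).
    by move: bx; rewrite cb_atE (cb_step_max _ mP).
  exact: (open_nbhs_nbhs (conj oU Ux)).
have [|g [V [gV gd]]] := @disjoint_plateaus _ _ cL _ p U p_inj.
  by move=> i; apply: open_nbhs_nbhs; split=> //; case: (pP i).
have g01 i z : 0 <= g i z <= 1 by have [_ _] := gV i.
have [i gi] := exists_small g01 gd nd.
have [oV Vp _ g0 g1] := gV i.
have VU : V i `<=` U.
  by move=> z Vz; apply: contrapT => /g0 /eqP; rewrite g1// oner_eq0.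
have [|z Vz|y [Py my]] := IH m mb (p i) (V i) oV _ Vp.
- by case: (pP i).
- by apply: fU; exact: VU.
have yt : y \in t.
  by apply: Pt; split=> //; apply: closureS Py; exact: sub_peaks.
have := Py _ (norm_lt_nbhs (@cspace_cts _ _ cK (T (g i)) y) (gi y yt)).
move=> [y' [[h [h01 h0] hc] gy']]; move: hc; apply/negP; rewrite -leNgt.
(* The first summand is bounded by 1: it is 2 h - 1 on [V i], 1 - 2 g on the rest of [U], and [f]
   outside [U]. The second adds less than 2 d near [y], so [c] cannot be exceeded. *)
have -> : f + 2 *: h = (f + 2 *: h - 2 *: g i) + 2 *: g i by rewrite subrK.
rewrite T_affine (le_trans (ler_normD _ _))//.
have : `|cspace_fun (T (f + 2 *: h - 2 *: g i)) y'| <= a.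
  apply: T_le => z; rewrite cspaceB cspaceD !cspaceZ.
  have [Vz|nVz] := pselect (V i z).
    rewrite fU ?g1//; last exact: VU.
    by rewrite ler_norml; have := h01 z; lra.
  rewrite h0//; have [Uz|nUz] := pselect (U z).
    by rewrite fU// ler_norml; have := g01 i z; lra.
  by rewrite g0// !mulr0 addr0 subr0.
have -> : `|2 * cspace_fun (T (g i)) y'| = 2 * `|cspace_fun (T (g i)) y'|
  by rewrite normrM ger0_norm.
by move: gy' => /=; rewrite /d; lra.
Qed.

Lemma nonzero_on_derivative (w : wotype) (b : w) x (U : set L)
    (f : cspace R cL) :
  open U -> cb_at L b x -> U x ->
  (forall z, `|f z| <= 1) -> (forall z, U z -> f z = 1) ->
  exists2 y, cb_at K b y & cspace_fun (T f) y <> 0.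
Proof.
move=> oU bx Ux f1 fU; have [y [Py by_]] := peaks_cluster oU bx Ux f1 fU.
exists y => // fy.
have d0 : `|cspace_fun (T f) y| < (c - a) / 2
  by rewrite fy normr0 divr_gt0// subr_gt0.
have [y' [[h [h01 h0] hc] fy']] :=
  Py _ (norm_lt_nbhs (@cspace_cts _ _ cK (T f) y) d0).
move: hc; apply/negP; rewrite -leNgt.
(* Here 2 h - f is 2 h - 1 on [U] and - f outside, hence bounded by 1, while [T f] is small near its
   zero [y]. *)
have -> : f + 2 *: h = (2 *: h - f) + 2 *: f.
  by rewrite [2 *: f]scaler_nat mulr2n addrA subrK addrC.
rewrite T_affine (le_trans (ler_normD _ _))//.
have : `|cspace_fun (T (2 *: h - f)) y'| <= a.
  apply: T_le => z; rewrite cspaceB cspaceZ.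
  have [Uz|nUz] := pselect (U z).
    by rewrite fU// ler_norml; have := h01 z; lra.
  by rewrite h0// mulr0 sub0r normrN.
have -> : `|2 * cspace_fun (T f) y'| = 2 * `|cspace_fun (T f) y'|
  by rewrite normrM ger0_norm.
by move: fy' => /=; lra.
Qed.

(** If the derivative of [K] had fewer than [n] points, a nontrivial combination of [n] plateau
    functions would have an image vanishing on all of them, against [nonzero_on_derivative]. *)
Lemma atleast_cb_at (w : wotype) (b : w) n :
  atleast n (cb_at L b) -> atleast n (cb_at K b).
Proof.
move=> /atleastP[p p_inj pb]; apply: contrapT => /natleast[t [_ tn Kt]].
have [|g [V [gV gd]]] := @disjoint_plateaus _ _ cL _ p setT p_inj.
  by move=> i; exact: filterT.
have g01 i z : 0 <= g i z <= 1 by have [_ _] := gV i.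
pose A := \matrix_(i < n, j < size t)
  cspace_fun (T (g i)) (tnth (in_tuple t) j).
have /rowV0Pn[u /sub_kermxP uA u0] : kermx A != 0.
  rewrite -mxrank_eq0 mxrank_ker -lt0n subn_gt0.
  exact: leq_ltn_trans (rank_leq_col _) tn.
have [i0 ui0] : exists i, u 0 i != 0.
  apply: contrapT => nu; move/eqP: u0; apply; apply/rowP => i; rewrite mxE.
  by apply/eqP; apply: contrapT => /negP ui; apply: nu; exists i.
(* Dividing by the coefficient of largest modulus makes the combination bounded by 1 and equal to 1
   on the plateau [V k]. *)
have [k _ kmax] :=
  @Order.TotalTheory.arg_maxP _ _ _ i0 xpredT (fun i => `|u 0 i|) isT.
have uk : 0 < `|u 0 k| by rewrite (lt_le_trans _ (kmax i0 isT))// normr_gt0.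
have uk0 : u 0 k != 0 by rewrite -normr_gt0.
pose f := \sum_(i < n) (u 0 i / u 0 k) *: g i.
have [oV Vp _ _ g1] := gV k.
have [z|z Vz|y] := nonzero_on_derivative (f := f) oV (pb k) Vp.
- apply: disjoint_comb_le => // [i|i j]; last exact: gd.
  by rewrite normrM normfV ler_pdivrMr// mul1r; exact: kmax.
- rewrite /f cspace_sum.
  have E i : cspace_fun ((u 0 i / u 0 k) *: g i) z = (i == k)%:R.
    rewrite cspaceZ; have [->|ik] := eqVneq i k.
      by rewrite g1// mulr1 divff.
    have [->|/eqP] := gd _ _ z ik; first by rewrite mulr0.
    by rewrite g1// oner_eq0.
  rewrite (eq_bigr _ (fun i _ => E i)) (bigD1 k isT) eqxx big1.
    exact: addr0.
  by move=> i /negbTE ->.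
rewrite Kt => /= yt; apply; rewrite /f T_sum.
have [j ->] : exists j, y = tnth (in_tuple t) j by apply/tnthP.
have := congr1 (fun B : 'rV_(size t) => B 0 j / u 0 k) uA.
rewrite !mxE mul0r mulr_suml; apply: etrans; apply: eq_bigr => i _.
by rewrite mxE mulrAC.
Qed.

End small_distortion.

(** * Cardinalities of derivatives and heights *)

Lemma card_le_atleast (S S' : topologicalType) (A : set S) (B : set S') n :
  A #<= B -> atleast n A -> atleast n B.
Proof.
move=> /card_leP[f] /atleastP[p p_inj pA].
pose q i : B := f (SigSub (mem_set (pA i))).
have q_inj : injective q.
  by move=> i j /inj; rewrite !in_setT => /(_ isT isT) /(congr1 val)/= /p_inj.
exists [seq val (q i) | i <- enum 'I_n]; split.
- by rewrite map_inj_uniq ?enum_uniq// => i j /val_inj/q_inj.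
- by rewrite size_map size_enum_ord.
- by move=> _ /mapP[i _ ->]; apply: set_mem; exact: valP.
Qed.

(** The height is a successor: otherwise the empty derivative would be the intersection of a
    decreasing chain of nonempty closed sets in a compact space. *)
Lemma height_max (S : topologicalType) (sS : scattered S) :
  hausdorff_space S -> compact [set: S] -> [set: S] !=set0 ->
  exists m : height sS, is_max [set: height sS] m.
Proof.
move=> hS cS S0; have [h0 hlt] := heightP sS.
apply: contrapT => nm; have := cb_step_lim (@cb_at S (height sS)) nm.
rewrite -/(cb S (height sS)) h0 => E.
have [| |y _|y [_]] := @compact_chain S _ [set: height sS] (@cb_at S _) _ cS S0.
- by move=> x; exact: closed_cb_at.
- exact: cb_at_anti.
- rewrite setTI; apply/set0P/eqP; rewrite -cb_oseg; apply: hlt.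
  exact: ord_lt_oseg.
by rewrite -E.
Qed.

(** When [K] is scattered, the inequality at ht(K) empties the derivative of [L] there, which forces
    [L] to be scattered and bounds its height. *)
Lemma ht_le_cb (L K : topologicalType) :
  (forall a : wotype, cb L a #<= cb K a) -> ht_le (ht L) (ht K).
Proof.
move=> LK; rewrite /ht; case: (pselect (scattered K)) => [sK|nK]; last first.
  by case: pselect.
have [hK0 _] := heightP sK.
have hL0 : cb L (height sK) = set0.
  by apply/eqP; rewrite -(@card_le0 _ K) -hK0 LK.
case: pselect => [sL /=|[]]; last first.
  by apply/seteqP; split=> // x /(@perfect_kernel_sub L (height sK));
    rewrite hL0.
have [_ hL_min] := heightP sL.
by have [//|/hL_min] := ord_le_or_lt (height sL) (height sK).
Qed.

(** At ht(L) - 1 the cardinality hypothesis decides; at earlier ordinals the derivative of [K] is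
    infinite, because the one at ht(L) - 1 is nonempty; at later ones that of [L] is empty. If [K]
    is not scattered, all its derivatives are infinite because they contain the perfect kernel. *)
Lemma ht_le_atleast (L K : topologicalType) (hL : hausdorff_space L)
    (hK : hausdorff_space K) (cL : compact [set: L]) (L0 : [set: L] !=set0) :
  ht_le (ht L) (ht K) ->
  (forall sL : scattered L,
    cb L (opred (height sL)) #<= cb K (opred (height sL))) ->
  forall w n, atleast n (cb L w) -> atleast n (cb K w).
Proof.
move=> LK top w n nL.
have inf (v : wotype) (B : set K) : B !=set0 -> B `<=` derived (cb K v) ->
    atleast n (cb K v).
  move=> [x Bx] /(_ _ Bx) dx; rewrite -[cb K v]setTI.
  by apply: (derived_atleast hK _ dx); exact: filterT.
have [sK|nK] := pselect (scattered K); last first.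
  apply: (inf w (@perfect_kernel K)); first by apply/set0P/eqP.
  rewrite -[X in X `<=` _]derived_perfect_kernel => x [Px lx].
  split; first exact: perfect_kernel_sub.
  move=> U /lx[y [yx Py Uy]]; exists y; split=> //; exact: perfect_kernel_sub.
have sL : scattered L.
  by move: LK; rewrite /ht; case: pselect => // _; case: pselect.
have [m mmax] := height_max sL hL cL L0.
have [h0 hlt] := heightP sL.
have gE : opred (height sL) = oseg m.
  rewrite /opred; case: pselect => [h|[]]; last by exists m.
  by rewrite (is_max_uniq (svalP (cid h)) mmax).
have {}top := top sL; rewrite gE in top.
have dL : derived (cb L (oseg m)) = set0.
  by rewrite cb_oseg -(cb_step_max _ mmax).
have [wm|/(cb_lt_derived (S := L))] := ord_le_or_lt w (oseg m); last first.
  rewrite dL => w0; have -> : n = 0%N; last exact: atleast0.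
  by apply: (@atleast_set0 L); apply: sub_atleast nL.
have [mw|/(cb_lt_derived (S := K)) wm'] := ord_le_or_lt (oseg m) w.
  have E S : cb S w = cb S (oseg m) by apply/seteqP; split; exact: cb_anti.
  by move: nL; rewrite !E; exact: card_le_atleast.
apply: inf wm'; apply/atleast1; apply: card_le_atleast top _; apply/atleast1.
by apply/set0P/eqP; apply: hlt; exact: ord_lt_oseg.
Qed.

(** * Operator norms and distortion below 3 *)

Section operator_norms.
Context (R : realType).

Lemma opnorm_ub (V W : normedModType R) (D : set V) (g : V -> W) x :
  bounded_op D g -> D x -> `|x| <= 1 -> `|g x| <= opnorm D g.
Proof.
move=> [M gM] Dx x1; apply: ub_le_sup; last by exists x.
exists `|M| => _ [z [Dz z1] <-]; apply: le_trans (gM _ Dz) _.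
apply: le_trans (_ : `|M| * `|z| <= _); last by rewrite ler_piMr.
by rewrite ler_wpM2r// ler_norm.
Qed.

Lemma opnorm_le (V W : normedModType R) (D : set V) (g : V -> W) (M : R) :
  D 0 -> (forall x, D x -> `|x| <= 1 -> `|g x| <= M) -> opnorm D g <= M.
Proof.
move=> D0 gM; apply: ge_sup => [|_ [x [Dx x1] <-]]; last exact: gM.
by exists `|g 0|, 0 => //; split=> //=; rewrite normr0.
Qed.

Lemma isometric_opnorm_lt3 (V W : normedModType R) (T : {linear V -> W}) :
  isometric_embedding T -> exists Tinv : W -> V,
    isomorphic_embedding T Tinv /\
    opnorm [set: V] T * opnorm (range T) Tinv < 3.
Proof.
move=> isoT.
have /choice[Tinv TinvP] : forall g, exists f, range T g -> T f = g.
  move=> g; have [[f _ fg]|nr] := pselect (range T g); first by exists f.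
  by exists 0.
have TK : cancel T Tinv.
  move=> f; have Tf : T (Tinv (T f)) = T f by apply: TinvP; exists f.
  by apply/eqP; rewrite -subr_eq0 -normr_eq0 -isoT linearB Tf subrr normr0.
have TinvE g : range T g -> `|Tinv g| = `|g| by move=> [f _ <-];
  rewrite TK isoT.
have bT : bounded_op setT T by exists 1 => f _; rewrite mul1r isoT.
have bTinv : bounded_op (range T) Tinv by exists 1 => g /TinvE ->;
  rewrite mul1r.
have r0 : range T 0 by exists 0 => //; rewrite linear0.
exists Tinv; split=> //.
have : opnorm [set: V] T <= 1 by apply: opnorm_le => // f _; rewrite isoT.
have : opnorm (range T) Tinv <= 1 by apply: opnorm_le => // g /TinvE ->.
have : 0 <= opnorm [set: V] T.
  by apply: le_trans (opnorm_ub bT (x := 0) _ _); rewrite ?normr0.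
have : 0 <= opnorm (range T) Tinv.
  by apply: le_trans (opnorm_ub bTinv r0 _); rewrite ?normr0.
by move=> ? ? ? ?; nra.
Qed.

Lemma opnorm_lt3_atleast (L : metricType R) (K : topologicalType)
    (L0 : [set: L] !=set0) (cL : compact [set: L]) (cK : compact [set: K])
    (hK : hausdorff_space K) (T : {linear cspace R cL -> cspace R cK})
    (Tinv : cspace R cK -> cspace R cL) :
  isomorphic_embedding T Tinv ->
  opnorm [set: cspace R cL] T * opnorm (range T) Tinv < 3 ->
  forall w n, atleast n (cb L w) -> atleast n (cb K w).
Proof.
move=> [bT TK bTinv]; set a := opnorm _ T; set b := opnorm _ Tinv => ab w n.
have fb f : `|f| <= b * `|T f|.
  have [->|f0] := eqVneq f 0; first by rewrite linear0 !normr0 mulr0.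
  have Tf0 : 0 < `|T f|.
    rewrite normr_gt0; apply: contra f0 => /eqP Tf.
    by rewrite -(TK f) Tf -(linear0 T) TK.
  rewrite -ler_pdivrMr//.
  have := opnorm_ub bTinv (x := `|T f|^-1 *: T f).
  rewrite -linearZ TK normrZ normfV normr_id mulrC; apply; first
    by exists (`|T f|^-1 *: f).
  by rewrite linearZ normrZ normfV normr_id mulVf// gt_eqF.
have cst3 : continuous (fun _ : L => 3 : R) by move=> z; exact: cvg_cst.
(* The nonzero constant function 3 on the nonempty space [L] rules out b <= 0. *)
have b0 : 0 < b.
  case: L0 => z _; rewrite ltNge; apply/negP => b0.
  have := cspace_norm_le (cspace_of cL cst3) z.
  rewrite cspace_ofE => /le_trans/(_ (fb _)).
  rewrite leNgt => /negP; apply; rewrite ger0_norm//.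
  by apply: le_lt_trans (_ : 0 < 3); rewrite // mulr_le0_ge0.
have a0 : 0 <= a by apply: le_trans (opnorm_ub bT (x := 0) _ _);
  rewrite ?normr0.
have a3 : a < 3 / b by rewrite ltr_pdivlMr.
(* The midpoint of [a] and 3 / b serves as [c]: a function reaching modulus 3 has an image of norm
   at least 3 / b by [fb]. *)
have [ac c3] : a < (a + 3 / b) / 2 /\ (a + 3 / b) / 2 < 3 / b by split; lra.
rewrite !cb_None.
apply: (@atleast_cb_at _ _ _ cL cK hK T a _ ac) => [f y f1|f z f3].
  apply: le_trans (cspace_norm_le _ y) _; apply: opnorm_ub => //.
  exact: cspace_norm_leP.
apply: contrapT => ny.
have : `|T f| <= (a + 3 / b) / 2.
  apply: cspace_norm_leP => [|y]; first by lra.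
  by rewrite leNgt; apply/negP => yc; apply: ny; exists y.
have : 3 / b <= `|T f|.
  rewrite ler_pdivrMr// mulrC; apply: le_trans (fb f).
  exact: le_trans (cspace_norm_le f z).
by lra.
Qed.

End operator_norms.

(** * Closed subsets mapping onto L *)

Section closed_subset_maps_onto.
Context (R : realType) (L : metricType R) (K : topologicalType).
Context (cK : compact [set: K]) (hK : hausdorff_space K).

(** Transfinite induction lifts each point to [F]. At limits the compact fibre over [x] meets all
    earlier derivatives, hence their intersection. At successors, lifts of points tending to [x]
    cluster at a point over [x]. *)
Lemma cb_at_image (F : set K) (phi : K -> L) (w : wotype) (b : w) :
  closed F -> {within F, continuous phi} -> phi @` F = [set: L] ->
  cb_at L b `<=` phi @` (cb_at K b).
Proof.
move=> cF /subspace_continuousP phiF onto x bx.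
have hL : hausdorff_space L by exact: metric_hausdorff.
have phiN y B : F y -> nbhs (phi y) B -> nbhs y [set z | F z -> B (phi z)].
  by move=> Fy /(phiF _ Fy).
suff [y [Fy <- by_]] : exists y, [/\ F y, phi y = x & cb_at K b y] by exists y.
elim/(well_founded_ind (@wlt_wf w)) : b x bx => b IH x bx.
have [[m mP]|nm] := pselect (exists m, is_max (seg b) m); last first.
  have fib_cl : closed (F `&` phi @^-1` [set x]).
    move=> y clFx; have Fy : F y by apply: cF => W /clFx[z [[Fz _] Wz]];
      exists z.
    split=> //; apply: hL => A B Ax By.
    have [z [[Fz zx] /(_ Fz) Az]] := clFx _ (phiN _ _ Fy Ax).
    by exists x; split; [rewrite -zx|exact: nbhs_singleton].
  have [|y| |y yb|y [[Fy yx] yb]] := @compact_chain K w (seg b) (@cb_at K w)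
      (F `&` phi @^-1` [set x]) (subclosed_compact fib_cl cK (@subsetT _ _)).
  - by have : [set: L] x by []; rewrite -onto => -[y Fy yx]; exists y.
  - exact: closed_cb_at.
  - exact: cb_at_anti.
  - have [z [Fz zx yz]] := IH _ yb x (cb_at_anti (wltW yb) bx).
    by exists z.
  - by exists y; split=> //; rewrite cb_atE cb_step_lim.
have [mb _] := mP; move: bx; rewrite (cb_atE L) (cb_step_max _ mP) => -[mx lx].
(* Requiring the image to differ from [x] keeps these lifts distinct from the cluster point over
   [x], which is therefore an accumulation point. *)
pose D (U : set L) := [set y | [/\ F y, cb_at K m y, U (phi y) & phi y <> x]].
pose G := filter_from (nbhs x) D.
have GG : ProperFilter G.
  apply: filter_from_proper; last first.
    move=> U /lx[x' [/eqP x'x mx' Ux']].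
    by have [y [Fy yx' my]] := IH _ mb x' mx'; exists y; split; rewrite ?yx'.
  apply: filter_from_filter; first by exists setT; exact: filterT.
  move=> U V Ux Vx; exists (U `&` V); first exact: filterI.
  by move=> y [Fy my [Uy Vy] yx]; split; split.
have GD U : nbhs x U -> G (D U) by move=> Ux; exists U.
have [|y [_ Gy]] := cK GG; first exact: filterT.
have Fy : F y.
  by apply: cF => W Wy; have [z [[Fz _ _ _] Wz]] := Gy _ _ (GD _ filterT) Wy;
    exists z.
have my : cb_at K m y.
  apply: (closed_cb_at hK) => W Wy.
  by have [z [[_ mz _ _] Wz]] := Gy _ _ (GD _ filterT) Wy; exists z.
have yx : phi y = x.
  apply: hL => A B Ay Bx.
  have [z [[Fz _ Bz _] Az]] := Gy _ _ (GD _ Bx) (phiN _ _ Fy Ay).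
  by exists (phi z); split=> //; exact: Az.
exists y; split=> //; rewrite cb_atE (cb_step_max _ mP); split=> // W Wy.
have [z [[_ mz _ zx] Wz]] := Gy _ _ (GD _ filterT) Wy.
by exists z; split=> //; apply/eqP => zy; apply: zx; rewrite zy.
Qed.

Lemma cb_card_le (F : set K) (phi : K -> L) :
  closed F -> {within F, continuous phi} -> phi @` F = [set: L] ->
  forall w, cb L w #<= cb K w.
Proof.
move=> cF phiF onto w; rewrite !cb_None.
apply: card_le_trans (card_image_le phi _).
exact: subset_card_le (cb_at_image cF phiF onto).
Qed.

Context (cL : compact [set: L]).

(* The evaluation functionals at the points of L are among those T* delta_y. *)
Definition attains_evaluations (T : cspace R cL -> cspace R cK) :=
  forall x, exists y, forall f, cspace_fun (T f) y = f x.

(** [F] collects the points of [K] at which [T] acts as an evaluation, and [phi] names the point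
    evaluated, with a dummy value outside [F]. Plateau functions separate points of [L], so that
    point is unique. *)
Lemma attains_evaluations_onto (T : cspace R cL -> cspace R cK) :
  [set: L] !=set0 -> attains_evaluations T ->
  exists (F : set K) (phi : K -> L),
    [/\ closed F, {within F, continuous phi} & phi @` F = [set: L]].
Proof.
move=> [x0 _] Tev; pose F := [set y | exists x, forall f,
  cspace_fun (T f) y = f x].
have /choice[phi phiP] : forall y, exists x, F y -> forall f,
  cspace_fun (T f) y = f x.
  by move=> y; have [[x yx]|nF] := pselect (F y); [exists x|exists x0].
exists F, phi; split.
(* Closedness: the points of [L] evaluated at members of [F] near [y] cluster at some [x] by
   compactness of [L], and [y] evaluates at [x]. *)
- move=> y Fy; pose D (W : set K) := [set x | exists2 z, W z & forall f,
    cspace_fun (T f) z = f x].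
  pose G := filter_from (nbhs y) D.
  have GG : ProperFilter G.
    apply: filter_from_proper; last first.
      by move=> W /Fy[z [[x zx] Wz]]; exists x, z.
    apply: filter_from_filter; first by exists setT; exact: filterT.
    move=> U V Uy Vy; exists (U `&` V); first exact: filterI.
    by move=> x [z [Uz Vz] zx]; split; exists z.
  have [|x [_ Gx]] := cL GG; first exact: filterT.
  exists x => f; apply: (@Rhausdorff R) => A B Ay Bx.
  have Ay' := @cspace_cts _ _ _ (T f) y _ Ay; have Bx' :=
    @cspace_cts _ _ _ f x _ Bx.
  have [|x' [[z Az zx'] Bx'']] :=
    Gx (D (cspace_fun (T f) @^-1` A)) _ _ Bx'; first
      by exists (cspace_fun (T f) @^-1` A).
  by exists (f x'); split=> //; rewrite -zx'.
- apply/subspace_continuousP => y Fy U Uy.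
  (* Continuity: [T g] is 1 at [y], so it stays positive nearby; for [z] in [F] this puts [phi z]
     where [g] is nonzero, hence in the given neighbourhood. *)
  have [g [V [_ Vx _ g0 g1]]] := @plateau _ _ cL _ _ Uy.
  have Ty : 0 < cspace_fun (T g) y by rewrite (phiP _ Fy) g1.
  have : nbhs y [set z | 0 < cspace_fun (T g) z].
    exact: (@cvgr_gt R K (nbhs y) _ _ _ (@cspace_cts _ _ _ (T g) y) 0 Ty).
  apply: filterS => z /= Tz Fz; apply: contrapT => /g0 gz.
  by move: Tz; rewrite (phiP _ Fz) gz ltxx.
- apply/seteqP; split=> // x _; have [y yx] := Tev x.
  have Fy : F y by exists x.
  exists y => //; apply: contrapT => yx'.
  have [|g [V [_ Vx _ g0 g1]]] := @plateau _ _ cL x (~` [set phi y]).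
    apply: open_nbhs_nbhs; split; last by move=> /esym.
    rewrite openC; apply: accessible_closed_set1; apply: hausdorff_accessible.
    exact: metric_hausdorff.
  have : g x = g (phi y) by rewrite -yx (phiP _ Fy).
  by rewrite g1// g0 => [/eqP|/=]; rewrite ?oner_eq0//; exact.
Qed.

End closed_subset_maps_onto.

(** * Splitting pairs of sets *)

Section splitting.
Context (R : realType) (L : metricType R) (K : topologicalType).
Context (cL : compact [set: L]) (cK : compact [set: K]).
Context (hK : hausdorff_space K).

Lemma urysohn_fun (A B : set K) : closed A -> closed B -> A `&` B = set0 ->
  exists u : K -> R, [/\ continuous u, forall y, A y -> u y = 0 &
    forall y, B y -> u y = 1].
Proof.
move=> cA cB AB.
have nK : normal_space K by exact: compact_normal.
have sep := normal_uniform_separator nK cA cB AB.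
exists (Urysohn A B); split; first exact: Urysohn_continuous.
- by move=> y Ay; apply: (Urysohn_sub0 sep); exists y.
- by move=> y By; apply: (Urysohn_sub1 sep); exists y.
Qed.

Lemma separate_finite (V : set K) (A0 A1 : seq K) : open V ->
  {in A0, forall y, V y} -> {in A1, forall y, V y} ->
  {in A0, forall y, y \notin A1} ->
  exists (V0 V1 : set K) (th : K -> R),
    [/\ open V0 /\ open V1, V0 `<=` V /\ V1 `<=` V,
        [set` A0] `<=` V0 /\ [set` A1] `<=` V1,
        continuous th /\ (forall y, 0 <= th y <= 1) &
        (forall y, closure V0 y -> th y = 0) /\
        (forall y, closure V1 y -> th y = 1)].
Proof.
move=> oV AV0 AV1 A01.
have cl (A : seq K) : closed [set` A].
  apply: compact_closed => //; apply: finite_compact; exact: finite_seq.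
have [|u [cu u0 u1]] := urysohn_fun (cl A0) (cl A1).
  by apply/seteqP; split=> // y [/= /A01/negP].
have o0 : open (u @^-1` [set r | r < 1 / 3]) by apply: open_comp => // ? _;
  exact: cu.
have o1 : open (u @^-1` [set r | r > 2 / 3]) by apply: open_comp => // ? _;
  exact: cu.
have c0 : closed (u @^-1` [set r | r <= 1 / 3]) by apply: preimage_closed =>
  //; exact: closed_le.
have c1 : closed (u @^-1` [set r | r >= 2 / 3]) by apply: preimage_closed =>
  //; exact: closed_ge.
(* On the closures [u] is at most 1 / 3, respectively at least 2 / 3, which is where 3 u - 1 clamps
   to 0, respectively 1. *)
exists (V `&` u @^-1` [set r | r < 1 / 3]), (V `&` u @^-1` [set r | r > 2 / 3]).
exists (fun y => Num.min 1 (Num.max 0 (3 * u y - 1))); split.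
- by split; exact: openI.
- by split; exact: subIsetl.
- split=> y /= yA; (split=> /=); [exact: AV0| |exact: AV1|].
    by rewrite u0//; lra.
  by rewrite u1//; lra.
- split; last by move=> y; rewrite le_min ler01 ge_min lexx/= le_max lexx.
  apply: clamp_continuous => y; apply: cvgB; last exact: cvg_cst.
  by apply: cvgMl_tmp; exact: cu.
- split=> y.
    have S : V `&` u @^-1` [set r | r < 1 / 3] `<=` u @^-1` [set r | r <= 1 /
      3].
      by move=> z [_ /ltW].
    move/(closureS S); rewrite -(closure_id _).1// => /= uy.
    have /max_idPl -> : 3 * u y - 1 <= 0 by lra.
    by apply/min_idPr.
  have S : V `&` u @^-1` [set r | r > 2 / 3] `<=` u @^-1` [set r | r >= 2 / 3].
    by move=> z [_ /ltW].
  move/(closureS S); rewrite -(closure_id _).1// => /= uy.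
  by apply/min_idPl; rewrite le_max; apply/orP; right; lra.
Qed.

Lemma closed_mdist (p : L) (A : set R) : closed A -> closed (mdist p @^-1` A).
Proof. by apply: preimage_closed => x _; exact: mdist_continuous. Qed.

Lemma atleastU (S : topologicalType) (A B U : set S) m n :
  A `<=` U -> B `<=` U -> A `&` B = set0 ->
  atleast m A -> atleast n B -> atleast (m + n) U.
Proof.
move=> AU BU AB [s [us <- sA]] [t [ut <- tB]]; exists (s ++ t); split.
- rewrite cat_uniq us ut andbT/=; apply/hasPn => x xt; apply/negP => xs.
  have : (A `&` B) x by split; [exact: sA|exact: tB].
  by rewrite AB.
- by rewrite size_cat.
- by move=> x; rewrite mem_cat => /orP[/sA/AU|/tB/BU].
Qed.

Lemma atleast_size (S : topologicalType) (A : set S) (t : seq S) n :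
  A `<=` [set` t] -> atleast n A -> (n <= size t)%N.
Proof. by move=> At [s [us <- sA]]; apply: uniq_leq_size us _ => x /sA/At. Qed.

(** For each point of [s] in turn, the interval shrinks to its outer third lying across the midpoint
    from that point. *)
Lemma avoid_finite (s : seq R) (x y : R) : x < y ->
  exists a b, [/\ x <= a, a < b, b <= y & forall r, a <= r <= b -> r \notin s].
Proof.
elim: s => [|z s IH] xy; first by exists x, y; split.
have [a [b [xa ab by_ abs]]] := IH xy.
have [zm|mz] := leP z ((a + b) / 2).
  exists ((a + 2 * b) / 3), b; split; [lra|lra|lra|] => r rab.
  rewrite inE negb_or abs; last by lra.
  by rewrite andbT; apply/eqP => rz; lra.
exists a, ((2 * a + b) / 3); split; [lra|lra|lra|] => r rab.
rewrite inE negb_or abs; last by lra.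
by rewrite andbT; apply/eqP => rz; lra.
Qed.

(** [top] stands for an ordinal at which the derivatives of [K] have reached the perfect kernel. *)
Context (w : wotype) (top : w).
Hypothesis top_max : forall x : w, wle x top.
Hypothesis top_perfect : derived (cb_at K top) = cb_at K top.

(** The finite comparison of derivatives localized to a piece of [L] and a piece of [K]: the
    invariant kept at every node of the tree. *)
Definition good (U : set L) (V : set K) := forall (x : w) n,
  atleast n (U `&` cb_at L x) -> atleast n (V `&` cb_at K x).

(** For the traces on [U] of the derivatives of [L], [g] and [n] play the roles of the predecessor
    of the height and of the cardinality there. *)
Definition last_derivative (U : set L) (g : w) (n : nat) :=
  [/\ (0 < n)%N, atleast n (U `&` cb_at L g), ~ atleast n.+1 (U `&` cb_at L g) &
      forall x, wlt g x -> U `&` cb_at L x = set0].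

(** By compactness the first ordinal with empty trace is a successor; the trace one step before has
    no accumulation point, hence is finite. *)
Lemma last_derivative_ex (U : set L) : closed U -> U !=set0 ->
  U `&` cb_at L top = set0 -> exists g n, last_derivative U g n.
Proof.
move=> cU U0 Utop; have hL : hausdorff_space L by exact: metric_hausdorff.
have cptU : compact U by exact: subclosed_compact cL _.
have [z z0 lz] :=
  @wle_min w [set z | U `&` cb_at L z = set0] (ex_intro _ top Utop).
have zlt x : wlt x z -> U `&` cb_at L x !=set0.
  by move=> xz; apply/set0P/eqP => /lz; apply/wltNge.
have [[g gP]|ng] := pselect (exists g, is_max (seg z) g); last first.
  have [y|x y|x xz|x] := @compact_chain L w (seg z) (@cb_at L w) U cptU U0.
  - exact: closed_cb_at.
  - exact: cb_at_anti.
  - exact: zlt.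
  - by rewrite -cb_step_lim// -cb_atE z0.
have [gz lg] := gP.
have [t tP] : exists t : seq L, U `&` cb_at L g `<=` [set` t].
  apply: compact_no_limit; first by apply: compact_closedI => //;
    exact: closed_cb_at.
  apply/seteqP; split=> // x [[Ux gx] lx]; rewrite -z0; split=> //.
  rewrite cb_atE (cb_step_max _ gP); split=> // W /lx[y [yx [_ gy] Wy]].
  by exists y.
have [n [n0 nP nSP]] : exists n, [/\ (0 < n)%N, atleast n (U `&` cb_at L g) &
    ~ atleast n.+1 (U `&` cb_at L g)].
  apply: contrapT => nn.
  have all n : atleast n.+1 (U `&` cb_at L g).
    elim: n => [|n IH]; first by apply/atleast1; exact: zlt.
    by apply: contrapT => nS; apply: nn; exists n.+1.
  by have := atleast_size tP (all (size t)); rewrite ltnn.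
exists g, n; split=> // x gx.
have zx : wle z x.
  have [/wltW//|->|/lg xg] := wlt_total z x; first exact: wle_refl.
  by case/wltNge: gx.
by apply/seteqP; split=> // y [Uy xy]; rewrite -z0; split=> //;
  exact: (cb_at_anti zx).
Qed.

(** An open set meeting the perfect part of [K] meets every derivative of [K] in infinitely many
    points. *)
Lemma good_top (U : set L) (V : set K) y :
  open V -> V y -> cb_at K top y -> good U V.
Proof.
move=> oV Vy Ky x n _; rewrite -top_perfect in Ky.
have := derived_atleast hK n Ky (open_nbhs_nbhs (conj oV Vy)).
by apply: sub_atleast => z [Vz Kz]; split=> //; apply: (cb_at_anti (top_max x)).
Qed.

Lemma derived_good (V : set K) (x g : w) n : open V -> wlt x g ->
  V `&` cb_at K g !=set0 -> atleast n (V `&` cb_at K x).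
Proof.
move=> oV xg [y [Vy gy]].
exact: (derived_atleast hK n (cb_at_lt xg gy) (open_nbhs_nbhs (conj oV Vy))).
Qed.

(** Only finitely many points are needed to make [V] good: before [g] they force infinitely many, at
    [g] they suffice by count, and after [g] the trace on [U] is empty. *)
Lemma good_last (U : set L) (V : set K) g n (A : seq K) : open V ->
  last_derivative U g n -> uniq A -> size A = n ->
  [set` A] `<=` V `&` cb_at K g ->
  good U V.
Proof.
move=> oV [n0 _ nS gtop] uA sA AV x m mU.
have An : atleast n (V `&` cb_at K g) by exists A; split.
have [xg|xg|gx] := wlt_total x g.
- by apply: derived_good xg _ => //; apply/atleast1; exact: leq_atleast An.
- rewrite xg; apply: leq_atleast An; rewrite leqNgt; apply/negP => nm.
  by apply: nS; rewrite -xg; exact: leq_atleast mU.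
- by move: mU; rewrite (gtop _ gx) => /atleast_set0 ->; exact: atleast0.
Qed.

(** Disjoint finite sets that force goodness of whatever open sets surround them, so those open sets
    can be shrunk until their closures are disjoint. *)
Definition good_seeds (V : set K) (U0 U1 : set L) := exists A0 A1 : seq K,
  [/\ {in A0, forall y, V y}, {in A1, forall y, V y},
      {in A0, forall y, y \notin A1},
      forall V', open V' -> [set` A0] `<=` V' -> good U0 V' &
      forall V', open V' -> [set` A1] `<=` V' -> good U1 V'].

Lemma good_seeds_sym (V : set K) (U0 U1 : set L) :
  good_seeds V U0 U1 -> good_seeds V U1 U0.
Proof.
move=> [A0 [A1 [? ? A01 ? ?]]]; exists A1, A0; split=> // y yA1.
by apply/negP => /A01; rewrite yA1.
Qed.

Lemma good_seeds_le (V : set K) (U U0 U1 : set L) g0 g1 n0 n1 :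
  open V -> good U V -> U0 `<=` U -> U1 `<=` U ->
  last_derivative U0 g0 n0 -> last_derivative U1 g1 n1 ->
  U0 `&` cb_at L g0 `&` (U1 `&` cb_at L g0) = set0 ->
  wle g1 g0 -> good_seeds V U0 U1.
Proof.
move=> oV UV U0U U1U U0P U1P dis g10.
have [n0_gt0 n0P _ _] := U0P; have [n1_gt0 n1P _ _] := U1P.
have VP0 : atleast n0 (V `&` cb_at K g0).
  by apply: UV; apply: sub_atleast n0P; exact: setSI.
have [A0 [uA0 sA0 A0P]] := VP0.
(* Enough points must remain outside [A0]. If g1 < g0 there are infinitely many; if g1 = g0 the two
   disjoint traces together give n0 + n1 points of [U], and goodness transfers this count to [V]. *)
have VP1 : atleast (size A0 + n1) (V `&` cb_at K g1).
  have [E|g10'] := wle_eqVlt g10; last first.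
    apply: derived_good g10' _ => //; apply/atleast1; exact: leq_atleast VP0.
  rewrite E in n1P *; apply: UV; rewrite sA0.
  by apply: (atleastU _ _ dis n0P n1P); exact: setSI.
have [A1 [uA1 sA1 A1P]] := atleast_notin VP1.
exists A0, A1; split.
- by move=> y /A0P[].
- by move=> y /A1P[[]].
- by move=> y yA0; apply/negP => /A1P[_]; rewrite /= yA0.
- move=> V' oV' AV'; apply: (good_last oV' U0P uA0 sA0) => y yA.
  by split; [exact: AV'|case: (A0P _ yA)].
- move=> V' oV' AV'; apply: (good_last oV' U1P uA1 sA1) => y yA.
  by split; [exact: AV'|case: (A1P _ yA) => -[]].
Qed.

(** The cut is along a sphere about [p], and both pieces keep the sphere so as to be closed. The
    radius is free in [e / 2, e], which leaves room to miss a finite set. *)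
Lemma split_cut (U : set L) (V : set K) (p : L) (e : R) :
  closed U -> open V -> good U V -> 0 < e ->
  exists U0 U1 : set L,
    [/\ closed U0 /\ closed U1, U = U0 `|` U1,
        forall x, U0 x -> mdist p x <= e, forall x, U1 x -> e / 2 <= mdist p x &
        U0 !=set0 -> U1 !=set0 -> good_seeds V U0 U1].
Proof.
move=> cU oV UV e0.
have cl0 r : closed (U `&` [set x | mdist p x <= r]).
  by apply: closedI => //; exact: (closed_mdist (p := p) (@closed_le _ r)).
have cl1 r : closed (U `&` [set x | r <= mdist p x]).
  by apply: closedI => //; exact: (closed_mdist (p := p) (@closed_ge _ r)).
suff [r [er re seeds]] : exists r, [/\ e / 2 <= r, r <= e &
    let U0 := U `&` [set x | mdist p x <= r] in
    let U1 := U `&` [set x | r <= mdist p x] in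
    U0 !=set0 -> U1 !=set0 -> good_seeds V U0 U1].
  exists (U `&` [set x | mdist p x <= r]), (U `&` [set x | r <= mdist p x]).
  split=> //.
  - apply/seteqP; split=> x; last by case=> -[].
    by move=> Ux; have [xr|/ltW rx] := leP (mdist p x) r; [left|right].
  - by move=> x [_ /= xr]; exact: le_trans re.
  - by move=> x [_ /= xr]; exact: le_trans xr.
have [[y [Vy Ky]]|nV] := pselect (V `&` cb_at K top !=set0).
  (* Where [V] meets the perfect part any radius works: two distinct points of that part are
     seeds. *)
  exists e; split; [lra|lra|] => U0 U1 _ _.
  have := Ky; rewrite -top_perfect => Ky'.
  have [[|y0 [|y1 s]] [us ss sA]] :=
    derived_atleast hK 2 Ky' (open_nbhs_nbhs (conj oV Vy)) => //.
  have [V0 K0] := sA y0 (mem_head _ _).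
  have [V1 K1] : (V `&` cb_at K top) y1 by apply: sA; rewrite !inE eqxx orbT.
  exists [:: y0], [:: y1]; split.
  - by move=> z; rewrite inE => /eqP->.
  - by move=> z; rewrite inE => /eqP->.
  - by move=> z; rewrite !inE => /eqP->; move: us => /= /andP[];
      rewrite inE negb_or => /andP[].
  - by move=> V' oV' AV'; apply: good_top oV' _ K0; apply: AV'; rewrite /= inE.
  - by move=> V' oV' AV'; apply: good_top oV' _ K1; apply: AV'; rewrite /= inE.
have Utop : U `&` cb_at L top = set0.
  apply/eqP; apply: contrapT => /negP/set0P/atleast1/UV/atleast1.
  exact: nV.
have [U0|nU] := pselect (U !=set0); last first.
  by exists e; split; [lra|lra|] => /= -[x [Ux _]]; case: nU; exists x.
have [g [n gP]] := last_derivative_ex cU U0 Utop.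
have [_ _ nS gtop] := gP.
have [t [_ _ tE]] := natleast nS.
have e2 : e / 2 < e by lra.
(* No point of the finite set U `&` cb_at L g lies in both halves of the cut. *)
have [a [b [ea ab be abt]]] := avoid_finite [seq mdist p x | x <- t] e2.
exists a; split; [lra|lra|] => S0 S1 W0 W1.
have sS0 : S0 `<=` U by exact: subIsetl.
have sS1 : S1 `<=` U by exact: subIsetl.
have topS S : S `<=` U -> S `&` cb_at L top = set0.
  by move=> SU; apply/seteqP; split=> // x [/SU Ux tx]; rewrite -Utop.
have [g0 [n0 g0P]] := last_derivative_ex (cl0 a) W0 (topS _ sS0).
have [g1 [n1 g1P]] := last_derivative_ex (cl1 a) W1 (topS _ sS1).
have dis : S0 `&` cb_at L g `&` (S1 `&` cb_at L g) = set0.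
  apply/seteqP; split=> // x [[[Ux /= xa] gx] [[_ /= ax] _]].
  have : mdist p x \notin [seq mdist p x | x <- t] by apply: abt; rewrite ax;
    lra.
  move=> /negP; apply; apply: map_f.
  by have : (U `&` cb_at L g) x by []; rewrite tE.
have le_g S h m : S `<=` U -> last_derivative S h m -> wle h g.
  move=> SU [m0 mS _ _]; apply: contrapT => /wltNge /gtop gh.
  have : (S `&` cb_at L h) !=set0 by apply/atleast1; exact: leq_atleast mS.
  by move=> [x [/SU Ux hx]]; have : (U `&` cb_at L h) x by []; rewrite gh.
have ge_g : wle g g0 \/ wle g g1.
  have [n0' nP _ _] := gP.
  have [x [Ux gx]] : U `&` cb_at L g !=set0 by apply/atleast1;
    exact: leq_atleast nP.
  have [xa|/ltW ax] := leP (mdist p x) a.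
    left; apply: contrapT => /wltNge g0g; have [_ _ _ /(_ _ g0g) E] := g0P.
    by have : (S0 `&` cb_at L g) x by []; rewrite E.
  right; apply: contrapT => /wltNge g1g; have [_ _ _ /(_ _ g1g) E] := g1P.
  by have : (S1 `&` cb_at L g) x by []; rewrite E.
(* The larger of [g0] and [g1] is [g], the ordinal at which the cut separates the traces; this is
   the disjointness that [good_seeds_le] asks for. *)
have [g10|g01] := wle_total g1 g0.
  have E : g0 = g.
    apply: wle_anti; first exact: le_g g0P.
    by case: ge_g => // /wle_trans; apply.
  by apply: (good_seeds_le (U := U)) g0P g1P _ g10 => //; rewrite E.
have E : g1 = g.
  apply: wle_anti; first exact: le_g g1P.
  by case: ge_g => // /wle_trans; apply.
apply: good_seeds_sym.
by apply: (good_seeds_le (U := U)) g1P g0P _ g01 => //; rewrite E setIC.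
Qed.

Definition admissible (P : set L * set K) :=
  [/\ closed P.1, open P.2 & good P.1 P.2].

(** [th] is the weight of the second child. It is constantly 0 or 1 when a child is empty, so that
    no weight falls on an empty piece of [L]. *)
Definition split_spec (P : set L * set K) (p : L) (e : R)
    (P0 P1 : set L * set K) (th : K -> R) :=
  [/\ admissible P0 /\ admissible P1,
      P.1 = P0.1 `|` P1.1 /\ (P0.2 `<=` P.2 /\ P1.2 `<=` P.2),
      (forall x, P0.1 x -> mdist p x <= e) /\
      (forall x, P1.1 x -> e / 2 <= mdist p x),
      [/\ continuous th, forall y, 0 <= th y <= 1,
          forall y, closure P0.2 y -> th y = 0 &
          forall y, closure P1.2 y -> th y = 1] &
      P.1 !=set0 -> (P0.1 = set0 -> forall y, th y = 1) /\
                    (P1.1 = set0 -> forall y, th y = 0)].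

Lemma split_ex (P : set L * set K) (p : L) (e : R) : admissible P -> 0 < e ->
  exists P0 P1 th, split_spec P p e P0 P1 th.
Proof.
case: P => U V [/= cU oV UV] e0.
have [U0 [U1 [[cU0 cU1] UE U0e U1e seeds]]] := split_cut p cU oV UV e0.
have cst (a : R) : continuous (fun _ : K => a) by move=> y; exact: cvg_cst.
have adm0 : admissible (set0, set0).
  split; [exact: closed0|exact: open0|] => x n.
  by rewrite set0I => /atleast_set0 ->; exact: atleast0.
have [U1n|/set0P U1n] := eqVneq U1 set0.
  have UU0 : U = U0 by rewrite UE U1n setU0.
  exists (U, V), (set0, set0), (fun=> 0); split=> //=.
  - by rewrite setU0; split=> [|] //; split.
  - by rewrite UU0.
  - by split=> // [y|y]; rewrite ?lexx ?ler01// closure0.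
  - by move=> [x Ux]; split=> // U0'; move: Ux; rewrite U0'.
have [U0n|/set0P U0n] := eqVneq U0 set0.
  have UU1 : U = U1 by rewrite UE U0n set0U.
  exists (set0, set0), (U, V), (fun=> 1); split=> //=.
  - by rewrite set0U; split=> [|] //; split.
  - by rewrite UU1.
  - by split=> // [y|y]; rewrite ?lexx ?ler01// closure0.
  - by move=> [x Ux]; split=> // U1'; move: Ux; rewrite U1'.
have [A0 [A1 [A0V A1V A01 good0 good1]]] := seeds U0n U1n.
have [V0 [V1 [th [[oV0 oV1] VV [AV0 AV1] [cth th01] [th0 th1]]]]] :=
  separate_finite oV A0V A1V A01.
exists (U0, V0), (U1, V1), th; split=> //=.
- by split; split=> //=; [exact: good0|exact: good1].
- move=> _; split=> E; first by move: U0n; rewrite E => -[].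
  by move: U1n; rewrite E => -[].
Qed.

End splitting.

(** * Averaging along a tree *)

Section compact_metric.
Context (R : realType) (L : metricType R) (cL : compact [set: L]).

Lemma finite_net (e : R) : 0 < e ->
  exists s : seq L, forall x, exists2 p, p \in s & mdist p x < e.
Proof.
move=> e0; apply: contrapT => ns.
pose D (s : seq L) := [set x | forall p, p \in s -> e <= mdist p x].
pose F := filter_from [set: seq L] D.
have FF : ProperFilter F.
  apply: filter_from_proper; last first.
    move=> s _; apply: contrapT => nD; apply: ns; exists s => x.
    apply: contrapT => nx; apply: nD; exists x => p ps; rewrite leNgt.
    by apply/negP => px; apply: nx; exists p.
  apply: filter_from_filter; first by exists [::].
  move=> s t _ _; exists (s ++ t) => // x Dx.
  by split=> p pst; apply: Dx; rewrite mem_cat pst ?orbT.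
have [|z [_ Fz]] := cL FF; first exact: filterT.
have [|x [Dx]] := Fz (D [:: z]) _ _ (nbhsx_ballx z e e0); first
  by exists [:: z].
by rewrite ballEmdist/= ltNge Dx ?mem_head.
Qed.

Lemma uniformly_continuous (f : cspace R cL) (e : R) : 0 < e ->
  exists2 d, 0 < d & forall x y, mdist x y < d -> `|f x - f y| < e.
Proof.
move=> e0; apply: contrapT => nd.
pose D (d : R) := [set x | exists2 y, mdist x y < d & e <= `|f x - f y|].
pose F := filter_from [set d : R | 0 < d] D.
have FF : ProperFilter F.
  apply: filter_from_proper; last first.
    move=> d /= d0; apply: contrapT => nD; apply: nd; exists d => // x y xy.
    by rewrite ltNge; apply/negP => fxy; apply: nD; exists x, y.
  apply: filter_from_filter; first by exists 1 => /=.
  move=> a b /= a0 b0; exists (Num.min a b); first by rewrite /= lt_min a0.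
  by move=> x [y]; rewrite lt_min => /andP[xa xb] fxy; split; exists y.
have [|z [_ Fz]] := cL FF; first exact: filterT.
have fz : nbhs z [set x | `|f z - f x| < e / 2].
  have := @cspace_cts _ _ cL f z; move/cvgrPdist_lt; apply; exact: divr_gt0.
have /nbhs_ballP[r /= r0 rz] := fz.
have r2 : 0 < r / 2 by rewrite divr_gt0.
have [|x [[y xy fxy] zx]] := Fz (D (r / 2)) _ _ (nbhsx_ballx z _ r2); first
  by exists (r / 2).
have zx' : mdist z x < r / 2 by move: zx; rewrite ballEmdist.
have fx : `|f z - f x| < e / 2 by apply: rz; rewrite ballEmdist/=; lra.
have fy : `|f z - f y| < e / 2.
  apply: rz; rewrite ballEmdist/=.
  by have := metric_triangle z x y; lra.
move: fxy; apply/negP; rewrite -ltNge.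
have -> : f x - f y = (f z - f y) - (f z - f x) by ring.
by apply: le_lt_trans (ler_normB _ _) _; lra.
Qed.

(** One sequence of centres and radii running through finite nets of all finenesses; level [k] of
    the tree is cut by the entry [q k]. *)
Lemma net_sequence : [set: L] !=set0 -> exists q : nat -> L * R,
  (forall k, 0 < (q k).2) /\
  forall e, 0 < e -> exists k0, forall x, exists k,
    [/\ (k < k0)%N, (q k).2 <= e & mdist (q k).1 x < (q k).2 / 2].
Proof.
move=> [x0 _].
have /choice[net netP] : forall m : nat, exists s : seq L,
    forall x, exists2 p, p \in s & mdist p x < m.+1%:R^-1 / 2.
  by move=> m; apply: finite_net; rewrite divr_gt0// invr_gt0.
pose q k : L * R := if @unpickle (nat * nat)%type k is Some (m, j)
  then (nth x0 (net m) j, m.+1%:R^-1) else (x0, 1).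
exists q; split=> [k|e e0].
  by rewrite /q; case: unpickle => [[m j]|]//=; rewrite invr_gt0.
(* With this [m] the radius 1 / (m + 1) is at most [e]; [k0] exceeds the codes of all points of the
   corresponding net. *)
pose m := Num.truncn e^-1.
exists (\max_(j < size (net m)) (pickle (m, nat_of_ord j)).+1) => x.
have [p pm px] := netP m x; have jm : (index p (net m) < size (net m))%N
  by rewrite index_mem.
exists (pickle (m, index p (net m))); rewrite /q pickleK /= nth_index//;
  split=> //.
  exact: (@leq_bigmax _ (fun j : 'I_(size (net m)) =>
    (pickle (m, nat_of_ord j)).+1) (Ordinal jm)).
by rewrite -[leRHS]invrK lef_pV2 ?posrE ?invr_gt0// ltW// truncnS_gt.
Qed.

End compact_metric.

(** A term of weight zero is left unbounded, since it comes from an empty child, where the mean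
    carries no information. *)
Lemma convex_between (R : realType) (t x y a b : R) : 0 <= t <= 1 ->
  (t = 1 \/ a <= x <= b) -> (t = 0 \/ a <= y <= b) ->
  a <= (1 - t) * x + t * y <= b.
Proof.
move=> /andP[t0 t1] [->|/andP[ax xb]].
  by case=> [/eqP|]; rewrite ?oner_eq0// subrr mul0r add0r mul1r.
case=> [->|/andP[ay yb]]; first by rewrite subr0 mul0r mul1r addr0 ax.
by apply/andP; split; nra.
Qed.

Section tree.
Context (R : realType) (L : metricType R) (K : topologicalType).
Context (L0 : [set: L] !=set0) (cL : compact [set: L]) (cK : compact [set: K]).
Context (hK : hausdorff_space K).
Hypothesis fin : forall w n, atleast n (cb L w) -> atleast n (cb K w).

(* A node is a word read from its end: b :: s is the child b of s. *)
Record tree_scheme (U : seq bool -> set L) (V : seq bool -> set K)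
    (th : seq bool -> K -> R) : Prop := TreeScheme {
  tree_root : U [::] = setT;
  tree_nonempty : forall s, U s !=set0 -> V s !=set0;
  tree_union : forall s, U s = U (false :: s) `|` U (true :: s);
  tree_sub : forall s b, V (b :: s) `<=` V s;
  tree_diam : forall e, 0 < e -> exists k0, forall s x y, (k0 <= size s)%N ->
    U s x -> U s y -> mdist x y <= e;
  tree_cts : forall s, continuous (th s);
  tree_01 : forall s y, 0 <= th s y <= 1;
  tree_closure : forall s y b, closure (V (b :: s)) y -> th s y = b%:R;
  tree_empty : forall s b, U s !=set0 -> U (b :: s) = set0 ->
    forall y, th s y = (~~ b)%:R }.

Lemma tree_scheme_ex : exists U V th, tree_scheme U V th.
Proof.
(* Passing to the successor gives a last element whose derivative is the perfect kernel itself. *)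
have [w0 w0P] := cb_perfect_kernel K; pose w := osucc w0; pose top : w := None.
have top_max x : wle x top by case: x.
have top_perfect : derived (cb_at K top) = cb_at K top.
  by rewrite -cb_None w0P derived_perfect_kernel.
have [q [q0 qdiam]] := net_sequence cL L0.
pose adm := @admissible R L K w.
have /choice[sp spP] : forall Q : (set L * set K) * (L * R),
    exists r : (set L * set K) * (set L * set K) * (K -> R),
    adm Q.1 -> 0 < Q.2.2 -> @split_spec R L K w Q.1 Q.2.1 Q.2.2 r.1.1 r.1.2 r.2.
  move=> [P [p e]]; have [[aP e0]|nP] := pselect (adm P /\ 0 < e).
    have [P0 [P1 [th thP]]] := split_ex cL cK hK top_max top_perfect p aP e0.
    by exists (P0, P1, th).
  by exists (P, P, fun=> 0) => /= aP e0; case: nP.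
pose fix node (s : seq bool) : set L * set K :=
  if s is b :: s' then
    let r := sp (node s', q (size s')) in if b then r.1.2 else r.1.1
  else (setT, setT).
have specP s : adm (node s) -> @split_spec R L K w (node s) (q (size s)).1
    (q (size s)).2 (node (false :: s)) (node (true :: s))
    (sp (node s, q (size s))).2.
  by move=> /(spP (node s, q (size s)))/(_ (q0 _)).
have nodeP s : adm (node s).
  elim: s => [|b s /specP[[a0 a1] _ _ _ _]]; last by case: b.
  split=> [||x n]; [exact: closedT|exact: openT|].
  by rewrite /= !setTI -!cb_oseg; exact: fin.
have {}specP s := specP s (nodeP s).
have subU s b : (node (b :: s)).1 `<=` (node s).1.
  by have [_ [-> _] _ _ _] := specP s; case: b => x; [right|left].
have subsU s t : (node (t ++ s)).1 `<=` (node s).1.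
  by elim: t => // b t IH; apply: subset_trans IH; exact: subU.
exists (fun s => (node s).1), (fun s => (node s).2),
  (fun s => (sp (node s, q (size s))).2); split.
- by [].
- move=> s [x Ux]; have [_ _ UV] := nodeP s.
  have [z _ lz] := @wle_min w [set: w] (ex_intro _ top I).
  have zT : cb_at L z = setT.
    rewrite cb_atE cb_step_lim; last first.
      by move=> [m [mz _]]; case/wltNge: mz; exact: lz.
    by apply/seteqP; split=> // t _ m mz; case/wltNge: mz; exact: lz.
  have /atleast1/UV/atleast1[y [Vy _]] : (node s).1 `&` cb_at L z !=set0.
    by exists x; rewrite zT.
  by exists y.
- by move=> s; have [_ [-> _] _ _ _] := specP s.
- by move=> s b; have [_ [_ [V0 V1]] _ _ _] := specP s; case: b.
- move=> e e0; have [|k0 k0P] := qdiam (e / 2); first by rewrite divr_gt0.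
  exists k0 => s x y k0s Ux Uy; have [k [kk0 qk px]] := k0P x.
  have ks : (k < size s)%N by exact: leq_trans k0s.
  (* Words grow at the front, so this suffix is the ancestor just after cut [k]. As [x] is within
     half the radius of the centre, that cut turned to the first child, and all of [U s] lies within
     the radius. *)
  have : size (drop (size s - k.+1) s) = k.+1 by rewrite size_drop subKn.
  move: Ux Uy; rewrite -{1 2}(cat_take_drop (size s - k.+1) s).
  case: (drop _ s) => [//|b s'] /subsU Ux /subsU Uy [sk].
  have [_ _ [U0 U1] _ _] := specP s'; rewrite sk in U0 U1.
  case: b Ux Uy => Ux Uy; first by have := U1 _ Ux; rewrite leNgt px.
  have := U0 _ Uy; have := metric_triangle x (q k).1 y.
  by rewrite (metric_sym x (q k).1); have := q0 k; lra.
- by move=> s; have [_ _ _ [? _ _ _] _] := specP s.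
- by move=> s; have [_ _ _ [_ ? _ _] _] := specP s.
- by move=> s y [] Vy; have [_ _ _ [_ _ c0 c1] _] := specP s;
    [exact: c1|exact: c0].
- by move=> s b Us; have [_ _ _ _ /(_ Us)[e0 e1]] := specP s; case: b => Ub y;
    [exact: e1|exact: e0].
Qed.

Context (U : seq bool -> set L) (V : seq bool -> set K).
Context (th : seq bool -> K -> R).
Hypothesis tr : tree_scheme U V th.

Lemma tree_point_ex :
  exists pt : seq bool -> L, forall s, U s !=set0 -> U s (pt s).
Proof.
have /choice[pt ptP] : forall s, exists x, U s !=set0 -> U s x; last
  by exists pt.
move=> s; have [[x Ux]|nU] := pselect (U s !=set0); first by exists x.
by case: L0 => x _; exists x => /nU.
Qed.

Context (pt : seq bool -> L).
Hypothesis ptP : forall s, U s !=set0 -> U s (pt s).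

(* The mean of f (pt t) over the words t extending s by n letters, the letter
   true being chosen at t with probability th t y. *)
Fixpoint mean (f : cspace R cL) (n : nat) (s : seq bool) (y : K) : R :=
  if n is m.+1 then
    (1 - th s y) * mean f m (false :: s) y + th s y * mean f m (true :: s) y
  else f (pt s).

Implicit Types f g : cspace R cL.

Lemma mean_linear a f g n s y :
  mean (a *: f + g) n s y = a * mean f n s y + mean g n s y.
Proof. by elim: n s => [//|n IH] s /=; rewrite !IH; ring. Qed.

Lemma mean_continuous f n s : continuous (mean f n s).
Proof.
elim: n s => [|n IH] s y /=; first exact: cvg_cst.
have ct : th s z @[z --> y] --> th s y by exact: (tree_cts tr).
apply: cvgD; apply: cvgM => //; try exact: IH.
by apply: cvgB => //; exact: cvg_cst.
Qed.

Let weights s y : U s !=set0 ->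
  (th s y = 1 \/ U (false :: s) !=set0) /\ (th s y = 0 \/ U (true :: s) !=set0).
Proof.
move=> Us; split.
  have [E|/set0P] := eqVneq (U (false :: s)) set0; last by right.
  by left; rewrite (tree_empty tr Us E).
have [E|/set0P] := eqVneq (U (true :: s)) set0; last by right.
by left; rewrite (tree_empty tr Us E).
Qed.

Let subU s b : U (b :: s) `<=` U s.
Proof. by rewrite (tree_union tr s); case: b => x; [right|left]. Qed.

Lemma mean_between f n s y (a b : R) : U s !=set0 ->
  (forall x, U s x -> a <= f x <= b) -> a <= mean f n s y <= b.
Proof.
elim: n s => [|n IH] s Us fab /=; first by apply: fab; exact: ptP.
have [w0 w1] := weights y Us.
apply: convex_between; first exact: (tree_01 tr).
  by case: w0 => [|Us0]; [left|right; apply: IH => // x /subU/fab].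
by case: w1 => [|Us1]; [left|right; apply: IH => // x /subU/fab].
Qed.

(** Below depth [k] further averaging only replaces a value of [f] by a mean of values on the same
    small set; averaging over the first [k] levels preserves the bound. *)
Lemma mean_cauchy f k m s y (e : R) : U s !=set0 ->
  (forall t x z, (k + size s <= size t)%N ->
    U t x -> U t z -> `|f x - f z| <= e) ->
  `|mean f (k + m) s y - mean f k s y| <= e.
Proof.
elim: k s => [|k IH] s Us osc.
  have /andP[] : f (pt s) - e <= mean f m s y <= f (pt s) + e.
    apply: mean_between => // x Ux; have :=
      osc s x (pt s) (leqnn _) Ux (ptP Us).
    by rewrite ler_norml => /andP[]; lra.
  by rewrite add0n /= ler_norml; lra.
rewrite addSn /=.
have [w0 w1] := weights y Us.
have -> : (1 - th s y) * mean f (k + m) (false :: s) y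
    + th s y * mean f (k + m) (true :: s) y
    - ((1 - th s y) * mean f k (false :: s) y + th s y * mean f k (true :: s) y)
  = (1 - th s y) * (mean f (k + m) (false :: s) y - mean f k (false :: s) y)
    + th s y * (mean f (k + m) (true :: s) y - mean f k (true :: s) y) by ring.
rewrite ler_norml; apply: convex_between; first exact: (tree_01 tr).
  case: w0 => [|Us0]; [by left|right; rewrite -ler_norml; apply: IH =>
    // t x z].
  by rewrite /= addnS; exact: osc.
case: w1 => [|Us1]; [by left|right; rewrite -ler_norml; apply: IH => // t x z].
by rewrite /= addnS; exact: osc.
Qed.

Lemma mean_uniform_cauchy f (e : R) : 0 < e ->
  exists k0, forall k m y, (k0 <= k)%N ->
  `|mean f (k + m) [::] y - mean f k [::] y| <= e.
Proof.
move=> e0; have [d d0 fd] := uniformly_continuous f e0.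
have [|k0 k0P] := tree_diam tr (e := d / 2); first by rewrite divr_gt0.
exists k0 => k m y kk0; apply: mean_cauchy; first by rewrite (tree_root tr).
move=> t x z; rewrite addn0 => kt Ux Uz; apply/ltW/fd.
apply: le_lt_trans (_ : d / 2 < d); last by lra.
by apply: k0P Ux Uz; exact: leq_trans kt.
Qed.

Lemma mean_cvg f y : cvgn (fun n => mean f n [::] y).
Proof.
apply/cauchy_cvgP/cauchyP => e e0.
have [|k0 k0P] := @mean_uniform_cauchy f (e / 2); first by rewrite divr_gt0.
exists (mean f k0 [::] y); exists k0 => // n /= kn.
rewrite /ball/= -(subnKC kn) distrC.
by apply: le_lt_trans (k0P k0 _ y (leqnn _)) _; lra.
Qed.

Let lmean f (y : K) : R := limn (fun n => mean f n [::] y).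

Lemma lmean_near f (e : R) : 0 < e -> exists k0, forall k y, (k0 <= k)%N ->
  `|lmean f y - mean f k [::] y| <= e.
Proof.
move=> e0; have [k0 k0P] := mean_uniform_cauchy f e0.
exists k0 => k y kk.
have c : `|mean f n [::] y - mean f k [::] y| @[n --> \oo] --> `|lmean f y -
  mean f k [::] y|.
  by apply: cvg_norm; apply: cvgB; [exact: mean_cvg|exact: cvg_cst].
rewrite -(cvg_lim (@Rhausdorff R) c); apply: limr_le; first by apply/cvg_ex;
  eexists; exact: c.
by exists k => // n /= kn; rewrite -(subnKC kn); exact: k0P.
Qed.

Lemma lmean_continuous f : continuous (lmean f).
Proof.
move=> y; apply/cvgrPdist_lt => e e0.
have [|k0 k0P] := @lmean_near f (e / 4); first by rewrite divr_gt0.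
have e4 : 0 < e / 4 by rewrite divr_gt0.
have := @mean_continuous f k0 [::] y; move/cvgrPdist_lt => /(_ _ e4).
apply: filterS => z yz.
have -> : lmean f y - lmean f z = (lmean f y - mean f k0 [::] y)
   + (mean f k0 [::] y - mean f k0 [::] z) - (lmean f z - mean f k0 [::] z)
     by ring.
have := k0P k0 y (leqnn _); have := k0P k0 z (leqnn _) => h1 h2.
apply: le_lt_trans (ler_normB _ _) _; have :=
  ler_normD (lmean f y - mean f k0 [::] y)
  (mean f k0 [::] y - mean f k0 [::] z).
by lra.
Qed.

Definition averaging (f : cspace R cL) : cspace R cK :=
  cspace_of cK (@lmean_continuous f).

Lemma averaging_linear : linear averaging.
Proof.
move=> a f g; apply: cspaceP => y.
rewrite cspaceD cspaceZ !cspace_ofE; apply: cvg_lim; first exact: Rhausdorff.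
under eq_fun do rewrite mean_linear.
by apply: cvgD; [apply: cvgMl_tmp|]; exact: mean_cvg.
Qed.

Lemma averaging_between f y (a b : R) : (forall x, a <= f x <= b) ->
  a <= cspace_fun (averaging f) y <= b.
Proof.
move=> fab.
have mab n : a <= mean f n [::] y <= b.
  by apply: mean_between => [|x _]; [rewrite (tree_root tr)|exact: fab].
apply/andP; split.
  by apply: limr_ge; [exact: mean_cvg|exists 0 => // n _; case/andP: (mab n)].
by apply: limr_le; [exact: mean_cvg|exists 0 => // n _; case/andP: (mab n)].
Qed.

(** Follow the branch of sets [U] containing [x]. By compactness some [y] lies in the closures of
    all the matching [V]; there every weight along the branch is 0 or 1, so the means at [y] are
    values of [f] at points tending to [x]. *)
Lemma averaging_attains : attains_evaluations averaging.
Proof.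
move=> x; pose fix br k : seq bool :=
  if k is j.+1 then `[< U (true :: br j) x >] :: br j else [::].
have brS k : br k.+1 = `[< U (true :: br k) x >] :: br k by [].
have Ubr k : U (br k) x.
  elim: k => [|k IH]; first by rewrite (tree_root tr).
  rewrite brS; case: asboolP => // nU.
  by move: IH; rewrite (tree_union tr) => -[].
have br_size k : size (br k) = k by elim: k => // k IH; rewrite brS /= IH.
have Vanti j k : (j <= k)%N -> V (br k) `<=` V (br j).
  move=> /subnKC <-; elim: (k - j)%N => [|n IH]; first by rewrite addn0.
  by rewrite addnS brS; apply: subset_trans IH; exact: (tree_sub tr).
pose F := filter_from [set: nat] (fun k => V (br k)).
have FF : ProperFilter F.
  apply: filter_from_proper; last first.
    by move=> k _; apply: (tree_nonempty tr); exists x.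
  apply: filter_from_filter; first by exists 0%N.
  by move=> j k _ _; exists (maxn j k) => // z Vz; split; apply: Vanti Vz;
    rewrite ?leq_maxl ?leq_maxr.
have [|y [_ Fy]] := cK FF; first exact: filterT.
have Vy k : closure (V (br k)) y by move=> W Wy; apply: Fy Wy; exists k.
exists y => f.
have mE n k : mean f n (br k) y = f (pt (br (k + n)%N)).
  elim: n k => [|n IH] k; first by rewrite addn0.
  rewrite addnS -addSn -IH brS /=.
  have := Vy k.+1; rewrite brS => /(tree_closure tr) ->.
  by case: asboolP => _; rewrite ?subrr ?subr0 ?mul0r ?mul1r ?addr0 ?add0r.
apply: cvg_lim; first exact: Rhausdorff.
apply/cvgrPdist_lt => e e0.
have [d d0 fd] := uniformly_continuous f e0.
have [|k0 k0P] := tree_diam tr (e := d / 2); first by rewrite divr_gt0.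
exists k0 => // n /= kn; rewrite (mE n 0%N) add0n; apply: fd.
apply: le_lt_trans (_ : d / 2 < d); last by lra.
apply: (k0P (br n)); rewrite ?br_size//.
by apply: ptP; exists x.
Qed.

End tree.

(** Averages stay between bounds of [f], which gives positivity and norm at most that of [f]; the
    attained evaluations give the reverse inequality. *)
Lemma atleast_attains_evaluations (R : realType) (L : metricType R)
    (K : topologicalType) (L0 : [set: L] !=set0) (cL : compact [set: L])
    (cK : compact [set: K]) (hK : hausdorff_space K) :
  (forall w n, atleast n (cb L w) -> atleast n (cb K w)) ->
  exists T : {linear cspace R cL -> cspace R cK},
    [/\ isometric_embedding T, positive_op T & attains_evaluations T].
Proof.
move=> fin; have [U [V [th tr]]] := tree_scheme_ex L0 cL cK hK fin.
have [pt ptP] := tree_point_ex L0 U.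
pose A := averaging L0 cK tr ptP : cspace R cL -> cspace R cK.
have Alin : linear A by exact: averaging_linear.
pose T : {linear cspace R cL -> cspace R cK} :=
  HB.pack A (GRing.isLinear.Build R (cspace R cL) (cspace R cK) _ A Alin).
have Tev : attains_evaluations T by exact: averaging_attains.
have between (f : cspace R cL) y (a b : R) : (forall x, a <= f x <= b) ->
    a <= cspace_fun (T f) y <= b by exact: averaging_between.
exists T; split=> // [f|f f0 y].
  apply/eqP; rewrite eq_le; apply/andP; split; apply: cspace_norm_leP => // z.
    by rewrite ler_norml; apply: between => x;
      rewrite -ler_norml cspace_norm_le.
  by have [y yz] := Tev z; rewrite -yz cspace_norm_le.
have /andP[//] : 0 <= cspace_fun (T f) y <= `|f|.
by apply: between => x; rewrite f0 (le_trans (ler_norm _))// cspace_norm_le.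
Qed.

Theorem theorem1p1 (R : realType) (L : metricType R) (K : topologicalType)
    (L0 : [set: L] !=set0) (cL : compact [set: L])
    (K0 : [set: K] !=set0) (cK : compact [set: K]) (hK : hausdorff_space K) :
  [<-> (* (i) *)
       exists T : {linear cspace R cL -> cspace R cK}, isometric_embedding T;
       (* (ii) *)
       exists (F : set K) (phi : K -> L),
         [/\ closed F, {within F, continuous phi} & phi @` F = [set: L]];
       (* (iii) *)
       forall a : wotype, cb L a #<= cb K a;
       (* (iv) *)
       ht_le (ht L) (ht K) /\
       (forall sL : scattered L,
         cb L (opred (height sL)) #<= cb K (opred (height sL)));
       (* (v) *)
       exists T : {linear cspace R cL -> cspace R cK},
         isometric_embedding T /\ positive_op T;
       (* (vi) *)
       exists (T : {linear cspace R cL -> cspace R cK})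
              (Tinv : cspace R cK -> cspace R cL),
         isomorphic_embedding T Tinv /\
         opnorm [set: cspace R cL] T * opnorm (range T) Tinv < 3].
Proof.
have hL : hausdorff_space L by exact: metric_hausdorff.
(* The finite comparison of derivatives is the hub: (i), (iv) and (vi) each imply it, and [embed]
   returns from it an operator that is isometric, positive and attains evaluations. *)
have embed := @atleast_attains_evaluations R L K L0 cL cK hK.
have fin_of_isometry (T : {linear cspace R cL -> cspace R cK}) :
    isometric_embedding T -> forall w n, atleast n (cb L w) ->
      atleast n (cb K w).
  by move=> /isometric_opnorm_lt3[Tinv []]; exact: opnorm_lt3_atleast.
tfae.
- move=> [T /fin_of_isometry/embed[S [_ _ Sev]]].
  exact: attains_evaluations_onto L0 Sev.
- by move=> [F [phi [cF phiF onto]]]; exact: (cb_card_le cK hK cF phiF onto).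
- by move=> LK; split=> //; exact: ht_le_cb.
- move=> [LK top].
  have [T [isoT posT _]] := embed (ht_le_atleast hL hK cL L0 LK top).
  by exists T.
- by move=> [T [/isometric_opnorm_lt3[Tinv TinvP] _]]; exists T, Tinv.
- move=> [T [Tinv [TTinv T3]]].
  have [S [isoS _ _]] := embed (opnorm_lt3_atleast L0 hK TTinv T3).
  by exists S.
Qed.
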